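(* Suppose $z:V(MG)\to\mathbb{C}$ is the tangency points of a circle packing with the combinatorics of a triangulated disk $G$, and $TMG$ is a triangulation of the medial graph $MG$ with $V(TMG)=V(MG)$. Then there is a one-to-one correspondence between holomorphic quadratic differentials of Koebe type $\lambda:E_{int}(G)\to\mathbb{R}$ and holomorphic quadratic differentials of general type $q:E_{int}(TMG)\to\mathbb{R}$. Furthermore, corresponding holomorphic quadratic differentials $\lambda$ and $q$ respectively define realizations $\mathcal{F}:F(G)\to\mathbb{C}^3$ and $\hat{\mathcal{F}}:F(TMG)\to\mathbb{C}^3$ via the Weierstrass representation formulas $$\mathcal{F}_{\mathrm{left}(e_{\mathfrak{uv}})}-\mathcal{F}_{\mathrm{right}(e_{\mathfrak{uv}})}=\frac{\lambda_{\mathfrak{uv}}}{\omega(e_{\mathfrak{uv}})}\begin{pmatrix}1-z_i^2\\ \mathbf{i}(1+z_i^2)\\ 2z_i\end{pmatrix}\quad(\{\mathfrak{uv}\}\in E_{int}(G)),$$ $$\hat{\mathcal{F}}_{\mathrm{left}(e_{ij})}-\hat{\mathcal{F}}_{\mathrm{right}(e_{ij})}=\frac{q_{ij}}{z_j-z_i}\begin{pmatrix}1-z_iz_j\\ \mathbf{i}(1+z_iz_j)\\ z_i+z_j\end{pmatrix}\quad(\{ij\}\in E_{int}(TMG)),$$ where in the first formula $z_i$ is the tangency point of $C_{\mathfrak u}$ and $C_{\mathfrak v}$. We have $$\hat{\mathcal{F}}|_{F(G)}=\mathcal{F}$$ up to a translation.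
   Context: Circle packing: $G=(V,E,F)$ is a triangulated disk with boundary. A circle packing in the plane with the combinatorics of $G$ associates to each vertex $\mathfrak{u}\in V(G)$ a circle $C_{\mathfrak{u}}\subset\mathbb{C}$ such that for every edge $\{\mathfrak{uv}\}\in E(G)$ the circles $C_{\mathfrak u}$ and $C_{\mathfrak v}$ touch. $V_{int}$, $E_{int}$ denote the sets of interior vertices and interior edges. $e_{\mathfrak{uv}}$ is the edge oriented from $\mathfrak u$ to $\mathfrak v$, and $\mathrm{left}(e)$, $\mathrm{right}(e)$ denote the left and right face of an oriented interior edge $e$. Medial graph: $MG$ has a vertex for every edge of $G$, realized by the tangency point $z$ of the two corresponding circles. Two vertices of $MG$ are connected by an edge if their corresponding edges of $G$ occur consecutively in a face of $G$. Each face of $MG$ corresponds either to a face of $G$ or to an interior vertex of $G$. $TMG$ is a triangulation of $MG$ without new vertices. A face $\{\mathfrak{uvs}\}$ of $G$ is identified with the face of $TMG$ formed by the three tangency points of $C_{\mathfrak u},C_{\mathfrak v},C_{\mathfrak s}$; this gives the injection $F(G)\hookrightarrow F(TMG)$ used in the restriction $\hat{\mathcal F}|_{F(G)}$. The function $\omega$: for an interior edge $\{\mathfrak{uv}\}$ of $G$ oriented from $\mathfrak u$ to $\mathfrak v$, with left face $\{\mathfrak{uvs}\}$ and right face $\{\mathfrak{vut}\}$, let $z_i,z_k,z_m$ be the tangency points of the pairs $(C_{\mathfrak u},C_{\mathfrak v})$, $(C_{\mathfrak s},C_{\mathfrak u})$, $(C_{\mathfrak t},C_{\mathfrak u})$ and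 put $\omega(e_{\mathfrak{uv}}):=\frac{(z_k-z_i)(z_m-z_i)}{z_m-z_k}=-\omega(e_{\mathfrak{vu}})$. Holomorphic quadratic differential of Koebe type: a function $\lambda:E_{int}(G)\to\mathbb{R}$ such that for every $\mathfrak u\in V_{int}(G)$, summing over the neighbors $\mathfrak v$ of $\mathfrak u$ (with $z_i$ the tangency point of $C_{\mathfrak u}$ and $C_{\mathfrak v}$), $\sum_{\mathfrak v}\frac{\lambda_{\mathfrak{uv}}}{\omega(e_{\mathfrak{uv}})}=0$, $\sum_{\mathfrak v}\frac{\lambda_{\mathfrak{uv}}}{\omega(e_{\mathfrak{uv}})}z_i=0$, $\sum_{\mathfrak v}\frac{\lambda_{\mathfrak{uv}}}{\omega(e_{\mathfrak{uv}})}z_i^2=0$. Holomorphic quadratic differential of general type (on the realization $z$ of $TMG$): a function $q:E_{int}(TMG)\to\mathbb{R}$, $q_{ij}=q_{ji}$, such that for every interior vertex $i$ of $TMG$, summing over all edges $\{ij\}$ at $i$, $\sum_j q_{ij}=0$ and $\sum_j\frac{q_{ij}}{z_j-z_i}=0$.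
   Formalization: TMG is taken as a triangulated disk that also fills the polygon of tangency points at each boundary vertex of G (else false: one interior vertex of degree 3 gives only λ=0 but q in R^3); tangency points of distinct edges at one vertex are assumed distinct, so denominators are nonzero. *)

(* Defs.v *)
From HB Require Import structures.
From mathcomp Require Import all_boot all_order all_algebra.
From mathcomp Require Import all_classical all_reals.
From mathcomp Require Import complex.

Set Implicit Arguments.
Unset Strict Implicit.
Unset Printing Implicit Defensive.

Import Order.TTheory GRing.Theory Num.Theory.

Local Open Scope ring_scope.

(* An oriented triangulation with vertices in V is given by its positively
   oriented faces: [G u v w] means that {u, v, w} is a face whose boundary,
   traversed counterclockwise, is u -> v -> w -> u.  The vertices and edges are
   those of the faces; elements of V on no face are irrelevant. *)
Section Triangulation.
Variables (V : finType) (G : V -> V -> V -> bool).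

Definition edge : rel V := fun u v => [exists w, G u v w || G v u w].

Definition int_edge : rel V :=
  fun u v => [exists s, G u v s] && [exists t, G v u t].

Definition vertices : {set V} := [set u | [exists v, edge u v]].

Definition edges : {set {set V}} :=
  [set [set p.1; p.2] | p in [set p : V * V | edge p.1 p.2]].

Definition int_edges : {set {set V}} :=
  [set [set p.1; p.2] | p in [set p : V * V | int_edge p.1 p.2]].

Definition faces : {set {set V}} :=
  [set [set p.1.1; p.1.2; p.2]
     | p in [set p : V * V * V | G p.1.1 p.1.2 p.2]].

Definition int_vertices : {set V} :=
  [set u in vertices | [forall v, edge u v ==> int_edge u v]].

Definition link (u : V) : rel V := fun v w => G u v w || G u w v.

(* The third vertex of the face on the left of u -> v; this is the junk value u
   when there is no such face. *)
Definition apex (u v : V) : V := odflt u [pick s | G u v s].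

Definition left_face (u v : V) : {set V} := [set u; v; apex u v].
Definition right_face (u v : V) : {set V} := [set v; u; apex v u].

(* A connected oriented simplicial surface: an oriented edge has at most one
   face on its left, and the link of a vertex is connected, hence a path or a
   cycle.  By the classification of compact surfaces, such a surface with
   nonempty boundary is a disk exactly when its Euler characteristic is 1. *)
Record triangulated_disk : Prop := TriangulatedDisk {
  face_rot : forall u v w, G u v w -> G v w u;
  face_neq : forall u v w, G u v w -> u != v;
  face_inj : forall u v w w', G u v w -> G u v w' -> w = w';
  face_or : forall u v w, G u v w -> ~~ G v u w;
  link_connected : forall u v w,
    edge u v -> edge u w -> connect (link u) v w;
  edge_connected : {in vertices &, forall u v, connect edge u v};
  boundary_neq0 : exists u v, edge u v && ~~ int_edge u v;
  euler_disk : (#|vertices| + #|faces| = #|edges| + 1)%N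
}.

End Triangulation.

Section Medial.
Variables (V : finType) (G : V -> V -> V -> bool).

(* The face of the medial triangulation identified with the face {u, v, s}. *)
Definition medial_face (u v s : V) : {set {set V}} :=
  [set [set u; v]; [set v; s]; [set s; u]].

(* A triangulation T of the medial graph without new vertices: its vertices are
   the edges of G.  The faces are the medial triangles (whose sides are all the
   edges of the medial graph) and triangles cutting up the polygons of the
   tangency points on the circle of one vertex u.
   At a boundary vertex u of G the medial edges only form a path; the condition
   on int_vertices means that the polygon obtained by joining the two boundary
   edges at u is triangulated too, so that T is again a disk, with one boundary
   vertex for each boundary edge of G. *)
Record medial_triangulation (T : {set V} -> {set V} -> {set V} -> bool) :
    Prop := MedialTriangulation {
  medial_disk : triangulated_disk T;
  medial_vertices : vertices T = edges G;
  medial_int_vertices : int_vertices T = int_edges G;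
  medial_faces : forall u v s,
    G u v s -> T [set u; v] [set v; s] [set s; u];
  medial_polygons : forall i j k, T i j k ->
    (exists u v s, G u v s /\ [set i; j; k] = medial_face u v s)
    \/ (exists u, [/\ u \in i, u \in j & u \in k])
}.

End Medial.

Section Differentials.
Variables (R : realType).
Local Notation C := R[i].

Definition is_circle (A : set C) : Prop :=
  exists (c : C) (r : R), 0 < r /\ A = [set w : C | `|w - c| = r%:C%C]%classic.

(* Two circles touch at p when p is their only common point.  Tangency points
   of distinct edges at a vertex are required to be distinct, as the
   denominators below demand; this is automatic when the disks bounded by the
   circles have disjoint interiors, which is not assumed. *)
Record circle_packing (V : finType) (G : V -> V -> V -> bool)
    (circ : V -> set C) (z : {set V} -> C) : Prop := CirclePacking {
  packing_circle : forall u, u \in vertices G -> is_circle (circ u);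
  packing_touch : forall u v, edge G u v ->
    (circ u `&` circ v = [set z [set u; v]%SET])%classic;
  packing_neq : forall u v w, edge G u v -> edge G u w -> v != w ->
    z [set u; v] != z [set u; w]
}.

Definition omega (V : finType) (G : V -> V -> V -> bool) (z : {set V} -> C)
    (u v : V) : C :=
  let zi := z [set u; v] in
  let zk := z [set apex G u v; u] in
  let zm := z [set apex G v u; u] in
  (zk - zi) * (zm - zi) / (zm - zk).

(* Functions on interior edges are encoded by their extension by zero. *)
Record koebe_differential (V : finType) (G : V -> V -> V -> bool)
    (z : {set V} -> C) (l : {ffun {set V} -> R}) : Prop := KoebeDifferential {
  koebe_support : forall e, e \notin int_edges G -> l e = 0;
  koebe_sum0 : forall u, u \in int_vertices G ->
    \sum_(v | edge G u v) (l [set u; v])%:C%C / omega G z u v = 0;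
  koebe_sum1 : forall u, u \in int_vertices G ->
    \sum_(v | edge G u v)
      (l [set u; v])%:C%C / omega G z u v * z [set u; v] = 0;
  koebe_sum2 : forall u, u \in int_vertices G ->
    \sum_(v | edge G u v)
      (l [set u; v])%:C%C / omega G z u v * z [set u; v] ^+ 2 = 0
}.

Record general_differential (W : finType) (T : W -> W -> W -> bool)
    (z : W -> C) (q : {ffun {set W} -> R}) : Prop := GeneralDifferential {
  general_support : forall e, e \notin int_edges T -> q e = 0;
  general_sum : forall i, i \in int_vertices T ->
    \sum_(j | edge T i j) q [set i; j] = 0;
  general_sumV : forall i, i \in int_vertices T ->
    \sum_(j | edge T i j) (q [set i; j])%:C%C / (z j - z i) = 0
}.

Definition vec3 (a b c : C) : 'cV[C]_3 := \col_k [:: a; b; c]`_k.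

Definition koebe_weierstrass (V : finType) (G : V -> V -> V -> bool)
    (z : {set V} -> C) (l : {ffun {set V} -> R}) (F : {set V} -> 'cV[C]_3) :
    Prop :=
  forall u v, int_edge G u v ->
    let zi := z [set u; v] in
    F (left_face G u v) - F (right_face G u v) =
    ((l [set u; v])%:C%C / omega G z u v)
      *: vec3 (1 - zi ^+ 2) ('i%C * (1 + zi ^+ 2)) (2 * zi).

Definition general_weierstrass (W : finType) (T : W -> W -> W -> bool)
    (z : W -> C) (q : {ffun {set W} -> R}) (F : {set W} -> 'cV[C]_3) : Prop :=
  forall i j, int_edge T i j ->
    F (left_face T i j) - F (right_face T i j) =
    ((q [set i; j])%:C%C / (z j - z i))
      *: vec3 (1 - z i * z j) ('i%C * (1 + z i * z j)) (z i + z j).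

(* The equations P on F have a solution on the faces of G, which is unique up
   to a translation. *)
Definition defines_realization (V : finType) (G : V -> V -> V -> bool)
    (P : ({set V} -> 'cV[C]_3) -> Prop) : Prop :=
  (exists F, P F) /\
  (forall F F', P F -> P F' ->
     exists t, forall f, f \in faces G -> F' f = F f + t).

End Differentials.

(* Main.v *)
(* Identify C^3 with the quadratic polynomials so that the edge vectors of the
   two Weierstrass formulas become multiples of (x - z_i)^2 and of
   (x - z_i)(x - z_j).  The polynomials F_f on the two faces f at the edge i of
   G then agree at z_i, and the polynomial of the general type on a triangle
   ijk of TMG is the one interpolating these common values at z_i, z_j, z_k; on
   a medial triangle this is F_f itself.  Jumps across ij vanish at z_i and z_j,
   which defines q.  That q is real comes from the real space of the polynomials
   which, as vector fields, are tangent to the circle C_u: the jumps of F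
   around u lie in it, hence so do the interpolants, up to one constant, and
   q / (z_j - z_i) (x - z_i)(x - z_j) lies in it exactly when q is real.
   Conversely, for q of general type, summing the jumps around the point z_i of
   the edge uv over its neighbours on C_u, or on C_v, shows that the difference
   of the polynomials of the two medial triangles at z_i is tangent to both
   circles; vanishing at z_i, it is a real multiple of (x - z_i)^2 / omega.
   The realizations exist because closed 1-forms on a disk are exact, which
   follows from Euler's formula by counting ranks. *)
Require Import Defs.
From mathcomp Require Import all_boot all_order all_algebra.
From mathcomp Require Import all_classical all_reals.
From mathcomp Require Import complex.
From mathcomp Require Import ring zify.

Set Implicit Arguments.
Unset Strict Implicit.
Unset Printing Implicit Defensive.

Import Order.TTheory GRing.Theory Num.Theory.
Local Open Scope ring_scope.

(** * Triangulated disks *)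

Lemma set2_inj (V : finType) (u v u' v' : V) :
  [set u; v] = [set u'; v'] -> u = u' /\ v = v' \/ u = v' /\ v = u'.
Proof.
move=> e.
have := set21 u v; rewrite e !inE => /orP[] /eqP eu.
- have := set22 u v; rewrite e !inE => /orP[] /eqP ev; last by left.
  have := set22 u' v'; rewrite -e !inE eu ev orbb => /eqP ->; by left.
- have := set22 u v; rewrite e !inE => /orP[] /eqP ev; first by right.
  have := set21 u' v'; rewrite -e !inE eu ev orbb => /eqP ->; by right.
Qed.

Lemma set3_rot (V : finType) (u v w : V) : [set u; v; w] = [set v; w; u].
Proof. by apply/setP=> x; rewrite !inE; case: (x == u); case: (x == v);
  case: (x == w). Qed.

Section Disk.
Variables (V : finType) (G : V -> V -> V -> bool).
Hypothesis hG : triangulated_disk G.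

Lemma face_rot2 u v w : G u v w -> G w u v.
Proof. by move=> /(face_rot hG)/(face_rot hG). Qed.

Lemma apexE u v s : G u v s -> apex G u v = s.
Proof.
rewrite /apex => h; case: pickP => [s' /= h'|/(_ s)]; last by rewrite h.
exact: (face_inj hG h' h).
Qed.

Lemma left_faceE u v s : G u v s -> left_face G u v = [set u; v; s].
Proof. by move=> h; rewrite /left_face (apexE h). Qed.

Lemma right_faceC u v : right_face G u v = left_face G v u.
Proof. by []. Qed.

Lemma right_faceE u v s : G v u s -> right_face G u v = [set v; u; s].
Proof. exact: left_faceE. Qed.

Lemma edgeC u v : edge G u v = edge G v u.
Proof. by apply/existsP/existsP=> -[w]; exists w; rewrite orbC. Qed.

Lemma int_edgeC u v : int_edge G u v = int_edge G v u.
Proof. by rewrite /int_edge andbC. Qed.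

Lemma int_edgeP u v :
  reflect (exists s t, G u v s /\ G v u t) (int_edge G u v).
Proof.
apply: (iffP andP) => [[/existsP[s hs] /existsP[t ht]]|[s [t [hs ht]]]].
  by exists s, t.
by split; apply/existsP; [exists s|exists t].
Qed.

Lemma face_edge u v w : G u v w -> edge G u v.
Proof. by move=> h; apply/existsP; exists w; rewrite h. Qed.

Lemma int_edgeW u v : int_edge G u v -> edge G u v.
Proof. by case/int_edgeP=> s [t [/face_edge]]. Qed.

Lemma edge_neq u v : edge G u v -> u != v.
Proof.
case/existsP=> w /orP[] /(face_neq hG) //; by rewrite eq_sym.
Qed.

Lemma edge_face u v : edge G u v -> exists w, G u v w \/ G v u w.
Proof. by case/existsP=> w /orP[]; exists w; [left|right]. Qed.

Lemma edge_vertex u v : edge G u v -> u \in vertices G.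
Proof. by move=> h; rewrite inE; apply/existsP; exists v. Qed.

Lemma mem_edges u v : edge G u v -> [set u; v] \in edges G.
Proof. by move=> h; apply/imsetP; exists (u, v); rewrite ?inE. Qed.

Lemma edgesP e :
  reflect (exists u v, e = [set u; v] /\ edge G u v) (e \in edges G).
Proof.
apply: (iffP imsetP) => [[[u v]]|[u [v [-> h]]]].
  by rewrite inE => h ->; exists u, v.
by exists (u, v); rewrite ?inE.
Qed.

Lemma int_edgesP e :
  reflect (exists u v, e = [set u; v] /\ int_edge G u v) (e \in int_edges G).
Proof.
apply: (iffP imsetP) => [[[u v]]|[u [v [-> h]]]].
  by rewrite inE => h ->; exists u, v.
by exists (u, v); rewrite ?inE.
Qed.

Lemma mem_int_edges u v : ([set u; v] \in int_edges G) = int_edge G u v.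
Proof.
apply/int_edgesP/idP => [[a [b [/set2_inj h]]]|h]; last by exists u, v.
by case: h => -[-> ->]; rewrite // int_edgeC.
Qed.

Lemma facesP f :
  reflect (exists u v w, f = [set u; v; w] /\ G u v w) (f \in faces G).
Proof.
apply: (iffP imsetP) => [[[[u v] w]]|[u [v [w [-> h]]]]].
  by rewrite inE => h ->; exists u, v, w.
by exists (u, v, w); rewrite ?inE.
Qed.

Lemma mem_faces u v w : G u v w -> [set u; v; w] \in faces G.
Proof. by move=> h; apply/facesP; exists u, v, w. Qed.

Lemma left_face_faces u v : int_edge G u v -> left_face G u v \in faces G.
Proof.
by case/int_edgeP=> s [t [h _]]; rewrite (left_faceE h); apply: mem_faces.
Qed.

Lemma right_face_faces u v : int_edge G u v -> right_face G u v \in faces G.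
Proof. by rewrite right_faceC int_edgeC; apply: left_face_faces. Qed.

Lemma apex_neq u v s t : G u v s -> G v u t -> s != t.
Proof.
move=> hs ht; apply/negP=> /eqP e; rewrite -e in ht.
have := face_or hG (face_rot2 hs); by rewrite (face_rot hG ht).
Qed.

Lemma int_vertex_edge u v : u \in int_vertices G -> edge G u v ->
  int_edge G u v.
Proof. by rewrite !inE => /andP[_ /forallP/(_ v)/implyP]. Qed.

(** [Q] passes between neighbouring faces at [u], and connectedness of the link of [u] lets it reach
    all of them. *)
Lemma link_propagate (Q : {set V} -> Prop) u :
  (forall v, int_edge G u v -> Q (left_face G u v) <-> Q (right_face G u v)) ->
  forall v w v' w', G u v w -> G u v' w' ->
    Q [set u; v; w] -> Q [set u; v'; w'].
Proof.
move=> hQ.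
(* [E v] speaks of whichever faces exist on the two sides of the edge from [u] to [v]; so it also
   makes sense at a boundary edge, where [left_face] or [right_face] is junk. *)
pose E v := forall w,
  (G u v w -> Q [set u; v; w]) /\ (G v u w -> Q [set v; u; w]).
have E1 v w : G u v w -> Q [set u; v; w] -> E v.
  move=> h q w'; split=> h'.
    by rewrite (face_inj hG h' h).
  have iv : int_edge G u v by apply/int_edgeP; exists w, w'.
  rewrite -(right_faceE h'); apply/(hQ v iv).
  by rewrite (left_faceE h).
have E2 v w : G v u w -> Q [set v; u; w] -> E v.
  move=> h q w'; split=> h'; last by rewrite (face_inj hG h' h).
  have iv : int_edge G u v by apply/int_edgeP; exists w', w.
  rewrite -(left_faceE h'); apply/(hQ v iv).
  by rewrite (right_faceE h).
have step x y : E x -> link G u x y -> E y.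
  move=> Ex /orP[] h.
    apply: (E2 y x); first exact: face_rot2.
    by rewrite -2!set3_rot; case: (Ex y) => + _; exact.
  apply: (E1 y x) => //.
  by rewrite -set3_rot; case: (Ex y) => _; apply; apply: face_rot2.
move=> v w v' w' h h' q.
have /connectP[p pth lst] := link_connected hG (face_edge h) (face_edge h').
suff /(_ w')[+ _] : E v' by apply.
rewrite {}lst.
have := E1 v w h q.
elim: p v pth {h q} => [|x p IH] v //= /andP[l pth] Ev.
by apply: IH => //; apply: step Ev l.
Qed.

(** A path of edges joins a vertex of [f] to a vertex of [f']. Around each vertex of the path
    [link_propagate] applies, and consecutive vertices share a face. *)
Lemma face_propagate (Q : {set V} -> Prop) :
  (forall u v, int_edge G u v ->
     Q (left_face G u v) <-> Q (right_face G u v)) ->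
  forall f f', f \in faces G -> f' \in faces G -> Q f -> Q f'.
Proof.
move=> hQ f f' /facesP[a [b [c [-> h]]]] /facesP[a' [b' [c' [-> h']]]].
pose E u := forall v w, G u v w -> Q [set u; v; w].
have E0 u v w : G u v w -> Q [set u; v; w] -> E u.
  by move=> g q v' w' g'; apply: (@link_propagate Q u _ v w) => // ? /hQ.
have step x y : E x -> edge G x y -> E y.
  move=> Ex /edge_face[w [g|g]].
    apply: (E0 y w x); first exact: (face_rot hG g).
    by rewrite -set3_rot; apply: Ex.
  apply: (E0 y x w) => //.
  by rewrite -2!set3_rot; apply: Ex; apply: (face_rot hG).
have /connectP[p pth lst] :=
  edge_connected hG (edge_vertex (face_edge h)) (edge_vertex (face_edge h')).
move=> q; suff : E a' by apply.
rewrite {}lst; have := E0 _ _ _ h q.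
elim: p a pth {h q} => [|x p IH] v //= /andP[l pth] Ev.
by apply: IH => //; apply: step Ev l.
Qed.

Lemma faces_nonempty : exists f, f \in faces G.
Proof.
have [u [v /andP[/edge_face[w]]]] := boundary_neq0 hG.
by move=> [] h _; eexists; apply: mem_faces h.
Qed.

(** * Sums of jumps around a vertex, and the boundary count *)

Section Telescope.
Variable (M : zmodType).
Implicit Type F : {set V} -> M.

(* Each face {u, v, w} lies on the left of u -> v and on the right of u -> w. *)
Lemma sum_jump F (P : pred V) u : u \in int_vertices G ->
  \sum_(v | edge G u v && P v) (F (left_face G u v) - F (right_face G u v)) =
  \sum_(p : V * V | G u p.1 p.2)
     (F [set u; p.1; p.2] *+ P p.1 - F [set u; p.1; p.2] *+ P p.2).
Proof.
move=> hu; rewrite !sumrB; congr (_ - _).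
  rewrite -(pair_big_dep xpredT (fun v w => G u v w)
             (fun v w => F [set u; v; w] *+ P v)) /=.
  rewrite [RHS](bigID (fun v => edge G u v && P v)) /= [X in _ + X]big1 ?addr0;
    last first.
    move=> v; rewrite negb_and => nv; rewrite big1 // => w /face_edge h.
    by move: nv; rewrite h /= => /negbTE ->.
  apply: eq_bigr => v /andP[/(int_vertex_edge hu)/int_edgeP[s [t [h _]]] ->].
  rewrite (left_faceE h) (big_pred1 s) // => w /=.
  by apply/idP/eqP=> [/(face_inj hG h)|->].
rewrite -(pair_big_dep xpredT (fun v w => G u v w)
           (fun v w => F [set u; v; w] *+ P w)) /=
             (exchange_big_dep xpredT) //=.
rewrite [RHS](bigID (fun v => edge G u v && P v)) /= [X in _ + X]big1 ?addr0;
  last first.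
  move=> v; rewrite negb_and => nv; rewrite big1 // => w /face_rot2/face_edge.
  by rewrite edgeC => h; move: nv; rewrite h /= => /negbTE ->.
apply: eq_bigr => v /andP[/(int_vertex_edge hu)/int_edgeP[s [t [_ h]]] ->].
rewrite (right_faceE h) (big_pred1 t) => [|w /=]; first by rewrite set3_rot.
by apply/idP/eqP=> [/face_rot2/(face_inj hG h)|->]; last exact: (face_rot hG).
Qed.

Lemma sum_jump0 F u : u \in int_vertices G ->
  \sum_(v | edge G u v) (F (left_face G u v) - F (right_face G u v)) = 0.
Proof.
move=> hu; transitivity
  (\sum_(v | edge G u v && predT v)
     (F (left_face G u v) - F (right_face G u v))).
  by apply: eq_bigl => v; rewrite andbT.
by rewrite sum_jump // big1 // => p _; rewrite subrr.
Qed.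
End Telescope.

(* The third vertex of the face on the right of u -> v has that face on its
   left, so at least as many edges at u have a face on the left as on the
   right. *)
Lemma boundary_next u : u \in vertices G -> u \notin int_vertices G ->
  exists v, [exists s, G u v s] && ~~ [exists t, G v u t].
Proof.
move=> hu; rewrite inE hu /= negb_forall => /existsP[v].
rewrite negb_imply => /andP[e ne]; apply/existsP; apply: contraT => /existsPn H.
(* Without such a [v], the ends [A] of edges with a face on the left lie among the ends [B] of edges
   with a face on the right. The count then gives [A = B], so every edge at [u] is interior. *)
pose A := [set v | [exists s, G u v s]].
pose B := [set v | [exists t, G v u t]].
have AB : A \subset B.
  by apply/fintype.subsetP=> x; rewrite !inE => hx; move: (H x);
    rewrite hx /= negbK.
have cBA : #|B| = #|A|.
  apply/eqP; rewrite eqn_leq (subset_leq_card AB) andbT.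
  have inj : {in B &, injective (apex G ^~ u)}.
    move=> x y; rewrite !inE => /existsP[s hs] /existsP[t ht].
    rewrite (apexE hs) (apexE ht) => st; rewrite st in hs.
    exact: (face_inj hG (face_rot hG hs) (face_rot hG ht)).
  rewrite -(card_in_imset inj); apply: subset_leq_card.
  apply/fintype.subsetP=> y /imsetP[x]; rewrite !inE => /existsP[s hs] ->.
  by rewrite (apexE hs); apply/existsP; exists x; apply: (face_rot hG).
have /eqP AeB : A == B by rewrite eqEcard AB cBA leqnn.
move: ne e; rewrite /int_edge.
have : (v \in A) = (v \in B) by rewrite AeB.
rewrite !inE => ->; rewrite andbb => /existsPn n2 /edge_face[w []] h.
  have : v \in B by rewrite -AeB inE; apply/existsP; exists w.
  by rewrite inE => /existsP[t]; rewrite (negbTE (n2 t)).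
by move: (n2 w); rewrite h.
Qed.

(** Each boundary vertex starts an edge with a face on its left only. This one-sidedness fixes the
    orientation, hence the starting vertex, so boundary vertices inject into boundary edges. *)
Lemma boundary_count :
  (#|vertices G| + #|int_edges G| <= #|edges G| + #|int_vertices G|)%N.
Proof.
have sV : int_vertices G \subset vertices G.
  by apply/fintype.subsetP=> x; rewrite inE => /andP[].
have sE : int_edges G \subset edges G.
  by apply/fintype.subsetP=> e /int_edgesP[u [v [-> h]]];
    apply/mem_edges/int_edgeW.
suff : (#|vertices G :\: int_vertices G| <= #|edges G :\: int_edges G|)%N.
  have := cardsID (int_vertices G) (vertices G).
  have := cardsID (int_edges G) (edges G).
  rewrite (finset.setIidPr sV) (finset.setIidPr sE); lia.
pose out u v := [exists s, G u v s] && ~~ [exists t, G v u t].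
pose nx u := odflt u [pick v | out u v].
have nxP u : u \in vertices G :\: int_vertices G -> out u (nx u).
  rewrite inE => /andP[h1 h2]; rewrite /nx; case: pickP => //= n.
  by have [v] := boundary_next h2 h1; rewrite -/(out u v) n.
have inj : {in vertices G :\: int_vertices G &,
    injective (fun u => [set u; nx u])}.
  move=> u u' /nxP/andP[_ n1] /nxP/andP[n2 _] /set2_inj[[]//|[e1 e2]].
  by move: n1 n2; rewrite -e1 -e2 => /negP.
rewrite -(card_in_imset inj); apply: subset_leq_card.
apply/fintype.subsetP=> _ /imsetP[u /nxP/andP[/existsP[s hs] n1] ->].
rewrite inE mem_edges ?(face_edge hs) // andbT mem_int_edges.
by rewrite /int_edge (negbTE n1) andbF.
Qed.
End Disk.

(** * Exactness of closed cochains *)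

Section Exactness.
Variables (V : finType) (G : V -> V -> V -> bool).
Hypothesis hG : triangulated_disk G.
Variable K : fieldType.

(** One orientation of each interior edge, selected by an enumeration of [V]: antisymmetric
    functions on oriented interior edges become row vectors. *)
Let O : {set V * V} :=
  [set p | int_edge G p.1 p.2 && (enum_rank p.1 < enum_rank p.2)%N].

Lemma card_oriented : (#|O| <= #|int_edges G|)%N.
Proof.
have inj : {in O &, injective (fun p : V * V => [set p.1; p.2])}.
  move=> [a b] [c d]; rewrite !inE /= => /andP[_ l1] /andP[_ l2].
  move=> /set2_inj[[-> ->]//|[e1 e2]]; move: l1 l2; rewrite e1 e2; lia.
rewrite -(card_in_imset inj); apply: subset_leq_card.
apply/fintype.subsetP=> _ /imsetP[[a b]] /[!inE] /= /andP[h _] ->.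
by rewrite (mem_int_edges G).
Qed.

(** [D0] and [D1] are the coboundary maps of the dual cell complex, acting on row vectors: faces of
    [G] are its vertices and interior vertices of [G] its 2-cells. *)
Let D0 : 'M[K]_(#|faces G|, #|O|) := \matrix_(f, e)
  ((enum_val f == left_face G (enum_val e).1 (enum_val e).2)%:R
   - (enum_val f == right_face G (enum_val e).1 (enum_val e).2)%:R).
Let D1 : 'M[K]_(#|O|, #|int_vertices G|) := \matrix_(e, u)
  (((enum_val e).1 == enum_val u)%:R - ((enum_val e).2 == enum_val u)%:R).

Lemma mulD0 (x : {set V} -> K) e :
  ((\row_f x (enum_val f)) *m D0) ord0 e =
  x (left_face G (enum_val e).1 (enum_val e).2)
  - x (right_face G (enum_val e).1 (enum_val e).2).
Proof.
have : enum_val e \in O := enum_valP e.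
rewrite inE => /andP[he _]; have he' := he; rewrite int_edgeC in he'.
rewrite mxE; under eq_bigr => f _ do rewrite !mxE mulrBr.
rewrite sumrB; congr (_ - _).
  rewrite -(big_enum_val (fun f => x f * (f == _)%:R)) /=.
  rewrite (bigD1 (left_face G (enum_val e).1 (enum_val e).2)) /=; last first.
    exact: left_face_faces.
  by rewrite eqxx mulr1 big1 ?addr0 // => f /andP[_ /negbTE ->]; rewrite mulr0.
rewrite -(big_enum_val (fun f => x f * (f == _)%:R)) /=.
rewrite (bigD1 (right_face G (enum_val e).1 (enum_val e).2)) /=; last first.
  exact: left_face_faces.
by rewrite eqxx mulr1 big1 ?addr0 // => f /andP[_ /negbTE ->]; rewrite mulr0.
Qed.

Lemma mulD1 (c : V -> V -> K) u :
  (forall a b, int_edge G a b -> c b a = - c a b) ->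
  ((\row_e c (enum_val e).1 (enum_val e).2) *m D1) ord0 u =
  \sum_(v | edge G (enum_val u) v) c (enum_val u) v.
Proof.
move=> anti; have ha := enum_valP u; set a := enum_val u in ha *.
rewrite mxE; under eq_bigr => f _ do rewrite !mxE -/a.
rewrite -(big_enum_val
  (fun p => c p.1 p.2 * ((p.1 == a)%:R - (p.2 == a)%:R))) /=.
(* The selected edges at [a] are sorted by whether [a] is their first or their second end. *)
transitivity (\sum_v
   ((if (a, v) \in O then c a v else 0) - (if (v, a) \in O then c v a else 0))).
  rewrite sumrB; under eq_bigr => p _ do rewrite mulrBr.
  rewrite sumrB; congr (_ - _).
    rewrite -big_mkcond /= [RHS](reindex_onto snd (pair a)) //=.
    rewrite [LHS](bigID (fun p => p.1 == a)) /= [X in _ + X]big1 ?addr0;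
      last first.
      by move=> p /andP[_ /negbTE ->]; rewrite mulr0.
    apply: eq_big => [[x y]|[x y] /andP[_ /= /eqP ->]] /=.
      rewrite xpair_eqE eqxx andbT eq_sym; case: eqP => [->|] //.
      by rewrite !andbF.
    by rewrite eqxx mulr1.
  rewrite -big_mkcond /= [RHS](reindex_onto fst (pair^~ a)) //=.
  rewrite [LHS](bigID (fun p => p.2 == a)) /= [X in _ + X]big1 ?addr0;
    last first.
    by move=> p /andP[_ /negbTE ->]; rewrite mulr0.
  apply: eq_big => [[x y]|[x y] /andP[_ /= /eqP ->]] /=.
    rewrite xpair_eqE eqxx eq_sym /=; case: eqP => [->|] //.
    by rewrite !andbF.
  by rewrite eqxx mulr1.
rewrite [RHS]big_mkcond; apply: eq_bigr => v _; rewrite !inE /= (int_edgeC G v).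
have -> : edge G a v = int_edge G a v.
  by apply/idP/idP => [/(int_vertex_edge ha)|/int_edgeW].
have [h|_] /= := boolP (int_edge G a v); last by rewrite subr0.
rewrite (anti _ _ h); case: ltngtP => [||/val_inj/enum_rank_inj e].
- by rewrite subr0.
- by rewrite sub0r opprK.
- by have := edge_neq hG (int_edgeW h); rewrite e eqxx.
Qed.

Lemma left_right_faceC a b (x : {set V} -> K) :
  x (left_face G b a) - x (right_face G b a) =
  - (x (left_face G a b) - x (right_face G a b)).
Proof. by rewrite opprB. Qed.

(** A function on faces killed by [D0] has no jumps, so it is constant by [face_propagate]: the
    kernel is at most a line. *)
Lemma rank_D0 : (#|faces G| <= (\rank D0).+1)%N.
Proof.
suff : (\rank (kermx D0) <= 1)%N by rewrite mxrank_ker; lia.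
apply: leq_trans (mxrankS (_ : (_ <= (const_mx 1 : 'rV[K]_#|faces G|))%MS))
  (rank_leq_row _).
apply/row_subP=> r; set x := row r _.
have xD : x *m D0 = 0 by rewrite -row_mul mulmx_ker row0.
have [f0 hf0] := faces_nonempty hG.
pose X f := x ord0 (enum_rank_in hf0 f).
have XD : \row_f X (enum_val f) = x.
  by apply/rowP=> f; rewrite mxE /X enum_valK_in.
have Xc f : f \in faces G -> X f = X f0.
  move=> hf; apply: (@face_propagate _ _ hG (fun f => X f = X f0) _ f0 f)
    => // a b.
  have jump p q : int_edge G p q -> (enum_rank p < enum_rank q)%N ->
      X (left_face G p q) = X (right_face G p q).
    move=> h l; have hO : (p, q) \in O by rewrite inE /= h.
    have := mulD0 X (enum_rank_in hO (p, q));
      rewrite XD xD mxE enum_rankK_in //=.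
    by move/esym/eqP; rewrite subr_eq0 => /eqP.
  move=> h; suff -> : X (left_face G a b) = X (right_face G a b) by [].
  have /negP nab := edge_neq hG (int_edgeW h).
  case: (ltngtP (enum_rank a) (enum_rank b))
    => [/(jump _ _ h)//||/val_inj/enum_rank_inj/eqP//].
  by rewrite int_edgeC in h; move=> /(jump _ _ h).
apply/sub_rVP; exists (X f0); apply/rowP=> f.
by rewrite -XD !mxE mulr1 Xc // enum_valP.
Qed.

(** A vector killed by the transpose of [D1] is a function on interior vertices that, extended by
    zero, agrees at the two ends of every edge. It vanishes on the boundary, so by connectedness
    everywhere. *)
Lemma rank_D1 : \rank D1 = #|int_vertices G|.
Proof.
apply/eqP; rewrite -mxrank_tr -[_ == _]/(row_free D1^T) -kermx_eq0.
apply/eqP/row_matrixP => r; rewrite row0.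
have : row r (kermx D1^T) *m D1^T = 0 by rewrite -row_mul mulmx_ker row0.
move: (row r _) => x xD.
have hu0 := enum_valP r.
pose X u := if u \in int_vertices G then x ord0 (enum_rank_in hu0 u) else 0.
have Xe u v : int_edge G u v -> (enum_rank u < enum_rank v)%N -> X u = X v.
  move=> h l; have hO : (u, v) \in O by rewrite inE /= h.
  have := congr1 (fun M : 'rV_ _ => M ord0 (enum_rank_in hO (u, v))) xD.
  rewrite !mxE; under eq_bigr => w _ do rewrite !mxE enum_rankK_in //= mulrBr.
  rewrite sumrB => /eqP; rewrite subr_eq0 => /eqP.
  have S w : \sum_(i < #|int_vertices G|) x ord0 i * (w == enum_val i)%:R = X w.
    transitivity (\sum_(i < #|int_vertices G|) X
      (enum_val i) * (w == enum_val i)%:R).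
      by apply: eq_bigr => i _; rewrite /X enum_valP enum_valK_in.
    rewrite -(big_enum_val (fun i => X i * (w == i)%:R)) /=.
    have [hw|nw] := boolP (w \in int_vertices G).
      rewrite (bigD1 w) //= eqxx mulr1 big1 ?addr0 // => i /andP[_].
      by rewrite eq_sym => /negbTE ->; rewrite mulr0.
    rewrite {2}/X (negbTE nw) big1 // => i hi; case: eqP => [wi|_];
      last by rewrite mulr0.
    by move: nw; rewrite wi hi.
  by rewrite !S.
suff X0 u : u \in vertices G -> X u = 0.
  apply/rowP=> i; rewrite [RHS]mxE; have hi := enum_valP i.
  have := X0 (enum_val i); rewrite /X hi enum_valK_in; apply.
  by move: hi; rewrite inE => /andP[].
have Xedge a b : edge G a b -> X a = X b.
  have [h|nh] := boolP (int_edge G a b).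
    have /negP nab := edge_neq hG (int_edgeW h).
    case: (ltngtP (enum_rank a) (enum_rank b))
      => [/(Xe _ _ h)//||/val_inj/enum_rank_inj/eqP//].
    by rewrite int_edgeC in h; move=> /(Xe _ _ h).
  have bd p q : edge G p q -> ~~ int_edge G p q -> X p = 0.
    by rewrite /X; case: ifP => // hp /(int_vertex_edge hp) ->.
  by move=> h; rewrite (bd a b) // (bd b a) // 1?edgeC // int_edgeC.
have [a [b /andP[eab nab]]] := boundary_neq0 hG.
have Xa : X a = 0.
  by rewrite /X; case: ifP => // ha; rewrite (int_vertex_edge ha eab) in nab.
move=> hu; have /connectP[p pth lst] := edge_connected hG (edge_vertex eab) hu.
rewrite {}lst; elim: p a Xa pth {eab nab} => //= y p IH a Xa /andP[ay pth].
by apply: IH => //; rewrite -(Xedge _ _ ay).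
Qed.

(* The kernel of D1 contains the image of D0; by Euler's formula, and since
   there are at most as many boundary vertices as boundary edges, its dimension
   is at most the rank of D0. *)
Lemma cochain_exact (c : V -> V -> K) :
  (forall u v, int_edge G u v -> c v u = - c u v) ->
  (forall u, u \in int_vertices G -> \sum_(v | edge G u v) c u v = 0) ->
  exists F : {set V} -> K, forall u v, int_edge G u v ->
    F (left_face G u v) - F (right_face G u v) = c u v.
Proof.
move=> anti closed; set r := \row_e c (enum_val e).1
  (enum_val e).2 : 'rV[K]_#|O|.
have D01 : D0 *m D1 = 0.
  apply/row_matrixP=> f; rewrite row0 row_mul.
  pose x g : K := (enum_val f == g)%:R.
  have -> : row f D0 = \row_e (x (left_face G (enum_val e).1 (enum_val e).2)
                           - x (right_face G (enum_val e).1 (enum_val e).2)).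
    by apply/rowP=> e; rewrite !mxE.
  apply/rowP=> u; rewrite [RHS]mxE.
  rewrite (mulD1 (c := fun a b => x (left_face G a b) - x
    (right_face G a b))) //.
    by rewrite sum_jump0 ?enum_valP.
  by move=> a b _; rewrite left_right_faceC.
have r0 : r *m D1 = 0.
  by apply/rowP=> u; rewrite mulD1 // closed ?mxE ?enum_valP.
(* With V, E, F for the numbers of vertices, edges and faces, the kernel of [D1] has dimension at
   most E_int - V_int <= E - V = F - 1, which is at most the rank of [D0]. *)
have /andP[_ le] : (D0 == kermx D1)%MS.
  rewrite -(geq_leqif (mxrank_leqif_eq _)) ?sub_kermx ?D01 //.
  rewrite mxrank_ker rank_D1.
  have := rank_D0; have := card_oriented; have := boundary_count hG.
  have := euler_disk hG; lia.
have /submxP[x rx] : (r <= D0)%MS by apply: submx_trans le; apply/sub_kermxP.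
have [f0 hf0] := faces_nonempty hG.
pose F f := x ord0 (enum_rank_in hf0 f).
have XD : \row_f F (enum_val f) = x.
  by apply/rowP=> f; rewrite mxE /F enum_valK_in.
have key u v : int_edge G u v -> (enum_rank u < enum_rank v)%N ->
    F (left_face G u v) - F (right_face G u v) = c u v.
  move=> h l; have hO : (u, v) \in O by rewrite inE /= h.
  by have := mulD0 F (enum_rank_in hO (u, v)); rewrite XD -rx mxE enum_rankK_in.
exists F => u v h; have /negP nab := edge_neq hG (int_edgeW h).
case: (ltngtP (enum_rank u) (enum_rank v))
  => [/(key _ _ h)//||/val_inj/enum_rank_inj/eqP//].
move=> l; have h' := h; rewrite int_edgeC in h'.
by apply: oppr_inj; rewrite -(left_right_faceC u v F) key // anti.
Qed.
End Exactness.

(** * Vector fields tangent to circles *)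

Section Circles.
Variable K : numClosedFieldType.
Implicit Types (a b c d k m x y rr : K) (Q : K -> K).

(** [rr] is the squared radius. In this form the conjugate of [x - c] on the circle is the rational
    expression [rr / (x - c)]. *)
Definition on_circle c rr x := (x - c) * (x - c)^* = rr.

(* [Q x / (x - c)] is imaginary on the circle, that is, the vector field [Q] is
   tangent to it; here [(x - c)^* = rr / (x - c)] has been used. *)
Definition tangent c rr Q :=
  forall x, on_circle c rr x -> (Q x)^* * (x - c) ^+ 2 = - rr * Q x.

Lemma on_circle_conj c rr x : rr != 0 -> on_circle c rr x ->
  x - c != 0 /\ (x - c)^* = rr / (x - c).
Proof.
rewrite /on_circle => r0 h; have x0 : x - c != 0.
  by apply: contra r0 => /eqP e; rewrite -h e mul0r.
by split=> //; rewrite -h mulrC mulKf.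
Qed.

Lemma tangentD c rr Q1 Q2 : tangent c rr Q1 -> tangent c rr Q2 ->
  tangent c rr (fun x => Q1 x + Q2 x).
Proof.
by move=> h1 h2 x hx; rewrite rmorphD mulrDl h1 // h2 // mulrDr.
Qed.

Lemma tangent0 c rr : tangent c rr (fun=> 0).
Proof. by move=> x _; rewrite conjC0 mul0r mulr0. Qed.

Lemma tangentN c rr Q : tangent c rr Q -> tangent c rr (fun x => - Q x).
Proof. by move=> h x /h e; rewrite rmorphN mulNr e mulrN. Qed.

Lemma tangent_ext c rr Q1 Q2 : Q1 =1 Q2 -> tangent c rr Q1 -> tangent c rr Q2.
Proof. by move=> e h x; rewrite -e; apply: h. Qed.


(** Relative to the centre, a point [y] of the circle has conjugate [rr / y]; this substitution
    turns tangency into an identity of rational functions. Several lemmas below are proved in the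
    same way. *)
Lemma tangent_chord c rr a b q : rr != 0 ->
  on_circle c rr a -> on_circle c rr b -> a != b -> q^* = q ->
  tangent c rr (fun x => q / (b - a) * ((x - a) * (x - b))).
Proof.
move=> r0 /(on_circle_conj r0)[a0 ac] /(on_circle_conj r0)[b0 bc] ab qr x.
move=> /(on_circle_conj r0)[x0 xc].
have sub y z : y - z = (y - c) - (z - c) by ring.
have ba : (b - c) - (a - c) != 0 by rewrite -sub subr_eq0 eq_sym.
rewrite (sub b a) (sub x a) (sub x b).
move: (a - c) (b - c) (x - c) a0 b0 x0 ac bc xc ba
  => A B X a0 b0 x0 ac bc xc ba.
rewrite !(rmorphM, rmorphB, fmorphV) /= ac bc xc qr.
have ba' : A - B != 0 by rewrite -oppr_eq0 opprB.
have -> : rr / B - rr / A = rr * (A - B) / (A * B) by field; rewrite a0 b0.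
by field; rewrite ?a0 ?b0 ?x0 ?r0 ?ba ?ba'.
Qed.

Lemma on_circle_opp c rr a : on_circle c rr a -> on_circle c rr (c - (a - c)).
Proof. by move=> h; rewrite /on_circle addrC addKr rmorphN /= mulrNN. Qed.

Lemma on_circle_quarter c rr a :
  on_circle c rr a -> on_circle c rr (c + 'i * (a - c)).
Proof.
move=> h; rewrite /on_circle addrC addKr rmorphM /= conjCi mulrACA.
by rewrite mulrN -expr2 sqrCi opprK mul1r.
Qed.

Lemma subi1_neq0 : 'i - 1 != 0 :> K.
Proof.
rewrite subr_eq0; apply/eqP => e; have := sqrCi K.
by rewrite e expr1n => /eqP; rewrite eq_sym eqNr oner_eq0.
Qed.

Lemma addi1_neq0 : 'i + 1 != 0 :> K.
Proof.
rewrite addr_eq0; apply/eqP => e; have := sqrCi K.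
by rewrite e sqrrN expr1n => /eqP; rewrite eq_sym eqNr oner_eq0.
Qed.

Lemma antipode_neq c a : a - c != 0 -> c - (a - c) != a.
Proof.
apply: contra => /eqP e; have : (a - c) *+ 2 = 0.
  by transitivity (a - (c - (a - c))); [ring | rewrite e subrr].
by move/eqP; rewrite mulrn_eq0.
Qed.

(** The antipode of [a] serves unless it is [b]; then the point a quarter turn from [a] does. *)
Lemma third_point c rr a b : rr != 0 -> on_circle c rr a -> on_circle c rr b ->
  exists x, [/\ on_circle c rr x, x != a & x != b].
Proof.
move=> r0 ha hb; have [a0 ac] := on_circle_conj r0 ha.
have n1 := antipode_neq a0.
have [e|nb] := eqVneq (c - (a - c)) b; last first.
  by exists (c - (a - c)); split=> //; apply: on_circle_opp.
exists (c + 'i * (a - c)); split; first exact: on_circle_quarter.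
  rewrite -subr_eq0 (_ : _ - a = ('i - 1) * (a - c)); last by ring.
  by rewrite mulf_neq0 ?subi1_neq0.
rewrite -e -subr_eq0 (_ : _ - _ = ('i + 1) * (a - c)); last by ring.
by rewrite mulf_neq0 ?addi1_neq0.
Qed.

(** Converse of [tangent_chord]: at a third point of the circle the chord polynomial does not
    vanish, so tangency there determines the conjugate of [e]. *)
Lemma tangent_chord_real c rr a b e : rr != 0 ->
  on_circle c rr a -> on_circle c rr b ->
  tangent c rr (fun x => e * ((x - a) * (x - b))) ->
  (e * (b - a))^* = e * (b - a).
Proof.
move=> r0 ha hb tg; have [x [hx xa xb]] := third_point r0 ha hb.
have := tg x hx; move: hx ha hb.
move=> /(on_circle_conj r0)[x0 xc] /(on_circle_conj r0)[a0 ac] /(on_circle_conj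
  r0)[b0 bc].
have sub y z : y - z = (y - c) - (z - c) by ring.
move: xa xb; rewrite -subr_eq0 -(subr_eq0 x b) (sub b a) (sub x a) (sub x b).
move: (a - c) (b - c) (x - c) a0 b0 x0 ac bc xc
  => A B X a0 b0 x0 ac bc xc xa xb.
rewrite !(rmorphM, rmorphB) /= ac bc xc => h.
have {}h : e^* * rr = - e * (A * B).
  apply: (mulfI (mulf_neq0 r0 (mulf_neq0 xa xb))).
  rewrite (_ : _ * (- e * (A * B)) = (A * B) * (- rr * (e * ((X - A) * (X
    - B))))); last by ring.
  by rewrite -h; field; rewrite a0 b0 x0.
have -> : e^* * (rr / B - rr / A) = e^* * rr * (A - B) / (A * B) by field;
  rewrite a0 b0.
by rewrite h; field; rewrite a0 b0.
Qed.

(** The map sending [x] to [(x - a)^-1] takes the circle to a line and a multiple of [(x - a) ^+ 2]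
    to a constant field. The inverse of the denominator is the difference of the images of [k] and
    [m], a direction of that line. *)
Lemma tangent_double c rr a k m l : rr != 0 ->
  on_circle c rr a -> on_circle c rr k -> on_circle c rr m ->
  k != a -> m != a -> m != k -> l^* = l ->
  tangent c rr (fun x => l / ((k - a) * (m - a) / (m - k)) * (x - a) ^+ 2).
Proof.
move=> r0 /(on_circle_conj r0)[a0 ac] /(on_circle_conj r0)[k0 kc].
move=> /(on_circle_conj r0)[m0 mc] ka ma mk lr x /(on_circle_conj r0)[x0 xc].
have sub y z : y - z = (y - c) - (z - c) by ring.
move: ka ma mk; rewrite -subr_eq0 -(subr_eq0 m a) -(subr_eq0 m k).
rewrite (sub k a) (sub m a) (sub m k) (sub x a).
move: (a - c) (k - c) (m - c) (x - c) a0 k0 m0 x0 ac kc mc xc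
  => A B M X a0 k0 m0 x0 ac kc mc xc ka ma mk.
rewrite !(rmorphM, rmorphB, fmorphV, rmorphXn) /= ac kc mc xc lr.
have ka' : A - B != 0 by rewrite -oppr_eq0 opprB.
have ma' : A - M != 0 by rewrite -oppr_eq0 opprB.
have mk' : B - M != 0 by rewrite -oppr_eq0 opprB.
have e y z : y != 0 -> z != 0 -> rr / y - rr / z = rr * (z - y) / (y * z).
  by move=> y0 z0; field; rewrite y0 z0.
rewrite !e //.
by field; rewrite ?a0 ?k0 ?m0 ?x0 ?r0 ?ka ?ma ?mk ?ka' ?ma' ?mk'.
Qed.

(** Converse of [tangent_double]: tangency at the single point [k] already determines the conjugate
    of [e]. *)
Lemma tangent_double_real c rr a k m e : rr != 0 ->
  on_circle c rr a -> on_circle c rr k -> on_circle c rr m ->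
  k != a -> m != a -> m != k -> tangent c rr (fun x => e * (x - a) ^+ 2) ->
  (e * ((k - a) * (m - a) / (m - k)))^* = e * ((k - a) * (m - a) / (m - k)).
Proof.
move=> r0 ha hk hm ka ma mk /(_ k hk); move: ha hk hm.
move=> /(on_circle_conj r0)[a0 ac] /(on_circle_conj r0)[k0 kc].
move=> /(on_circle_conj r0)[m0 mc].
have sub y z : y - z = (y - c) - (z - c) by ring.
move: ka ma mk; rewrite -subr_eq0 -(subr_eq0 m a) -(subr_eq0 m k).
rewrite (sub k a) (sub m a) (sub m k).
move: (a - c) (k - c) (m - c) a0 k0 m0 ac kc mc
  => A B M a0 k0 m0 ac kc mc ka ma mk.
rewrite !(rmorphM, rmorphB, fmorphV, rmorphXn) /= ac kc mc => h.
have {}h : e^* * rr = - e * A ^+ 2.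
  apply: (mulfI (mulf_neq0 r0 (expf_neq0 2 ka))).
  rewrite (_ : _ * (- e * A ^+ 2) = A ^+ 2 * (- rr * (e * (B - A) ^+ 2)));
    last by ring.
  by rewrite -h; field; rewrite a0 k0.
have mk' : B - M != 0 by rewrite -oppr_eq0 opprB.
have f y z : y != 0 -> z != 0 -> rr / y - rr / z = rr * (z - y) / (y * z).
  by move=> y0 z0; field; rewrite y0 z0.
rewrite !f //.
have -> : e^* * (rr * (A - B) / (B * A) * (rr * (A - M) / (M * A)) / (rr * (B
  - M) / (M * B)))
  = e^* * rr * ((A - B) * (A - M) / (A ^+ 2 * (B - M))).
  by field; rewrite ?a0 ?k0 ?m0 ?r0 ?mk'.
by rewrite h; field; rewrite ?a0 ?mk ?mk'.
Qed.

(* The Lagrange basis polynomials of three points of a circle are complex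
   multiples of chord polynomials, and the reality of the values of [Q] at the
   points makes these multiples real. *)
Lemma tangent_interp c rr a b d e0 e1 e2 : rr != 0 ->
  let Q x := e2 * x ^+ 2 + e1 * x + e0 in
  on_circle c rr a -> on_circle c rr b -> on_circle c rr d ->
  a != b -> b != d -> d != a ->
  (Q a)^* * (a - c) ^+ 2 = - rr * Q a ->
  (Q b)^* * (b - c) ^+ 2 = - rr * Q b ->
  (Q d)^* * (d - c) ^+ 2 = - rr * Q d -> tangent c rr Q.
Proof.
move=> r0 Q ha hb hd ab bd da qa qb qd.
pose f a b d := Q a * (d - b) / ((a - b) * (a - d)).
have freal x y z : on_circle c rr x -> on_circle c rr y -> on_circle c rr z ->
    x != y -> z != x -> (Q x)^* * (x - c) ^+ 2 = - rr * Q x ->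
      (f x y z)^* = f x y z.
  rewrite /f; move: (Q x) => q.
  move=> /(on_circle_conj r0)[x0 xc] /(on_circle_conj r0)[y0 yc].
  move=> /(on_circle_conj r0)[z0 zc].
  have sub u v : u - v = (u - c) - (v - c) by ring.
  rewrite -subr_eq0 -(subr_eq0 z) (sub z y) (sub x y) (sub z x) (sub x z).
  move: (x - c) (y - c) (z - c) x0 y0 z0 xc yc zc
    => X Y Z x0 y0 z0 xc yc zc xy zx h.
  rewrite !(rmorphM, rmorphB, fmorphV) /= xc yc zc.
  have -> : q^* = - rr * q / X ^+ 2 by rewrite -h mulfK ?expf_neq0.
  have g u v : u != 0 -> v != 0 -> rr / u - rr / v = rr * (v - u) / (u * v).
    by move=> u0 v0; field; rewrite u0 v0.
  have xy' : Y - X != 0 by rewrite -oppr_eq0 opprB.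
  have zx' : X - Z != 0 by rewrite -oppr_eq0 opprB.
  by rewrite !g //; field; rewrite ?x0 ?y0 ?z0 ?r0 ?xy ?xy' ?zx ?zx'.
have t x y z : on_circle c rr x -> on_circle c rr y -> on_circle c rr z ->
    x != y -> y != z -> z != x -> (Q x)^* * (x - c) ^+ 2 = - rr * Q x ->
    tangent c rr (fun w => f x y z / (z - y) * ((w - y) * (w - z))).
  by move=> hx hy hz xy yz zx h; apply: tangent_chord => //; apply: freal.
have ta := t _ _ _ ha hb hd ab bd da qa.
have tb := t _ _ _ hb hd ha bd da ab qb.
have td := t _ _ _ hd ha hb da ab bd qd.
apply: tangent_ext (tangentD (tangentD ta tb) td) => x; rewrite /f /Q.
have ab0 : a - b != 0 by rewrite subr_eq0.
have ba0 : b - a != 0 by rewrite subr_eq0 eq_sym.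
have bd0 : b - d != 0 by rewrite subr_eq0.
have db0 : d - b != 0 by rewrite subr_eq0 eq_sym.
have da0 : d - a != 0 by rewrite subr_eq0.
have ad0 : a - d != 0 by rewrite subr_eq0 eq_sym.
by field; rewrite ?ab0 ?ba0 ?bd0 ?db0 ?da0 ?ad0.
Qed.

(** Tangency at the antipode of [a] and at a quarter turn from [a] gives two linear relations
    between [e], [d] and their conjugates. *)
Lemma tangent_simple_zero c rr a e d : rr != 0 -> on_circle c rr a ->
  tangent c rr (fun x => (x - a) * (e * (x - a) + d)) ->
  d = e * (a - c) + (e * (a - c))^*.
Proof.
move=> r0 ha tg; have [a0 ac] := on_circle_conj r0 ha.
have i2 := sqrCi K.
have := tg _ (on_circle_quarter ha); have := tg _ (on_circle_opp ha).
have -> : c - (a - c) - a = - ((a - c) *+ 2) by ring.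
have -> : c - (a - c) - c = - (a - c) by ring.
have -> : c + 'i * (a - c) - a = ('i - 1) * (a - c) by ring.
have -> : c + 'i * (a - c) - c = 'i * (a - c) by ring.
move: (a - c) a0 ac => A a0 ac.
rewrite !(rmorphM, rmorphB, rmorphD, rmorphN, rmorphMn) /= conjCi conjC1 ac
  (exprMn _ 'i) i2.
move: e^* d^* => E D e1 e2.
have {}e1 : 2 * (E * (rr / A)) - D = - (2 * (e * A)) + d.
  apply: (mulfI (mulf_neq0 (mulf_neq0 r0 a0) (_ : 2 != 0 :> K)));
    first by rewrite pnatr_eq0.
  rewrite (_ : _ * (_ + d) = - rr * (- (A *+ 2) * (e * - (A *+ 2) + d)));
    last by ring.
  by rewrite -e1; field.
have {}e2 : (1 - 'i) * (E * (rr / A)) + 'i * D = ('i - 1) * (e * A) + d.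
  apply: (mulfI (mulf_neq0 (mulf_neq0 r0 a0) subi1_neq0)).
  rewrite (_ : _ * (_ + d) = - (- rr * (('i - 1) * A * (e * (('i - 1) * A)
    + d)))); last by ring.
  rewrite -e2.
  have -> : rr * A * ('i - 1) * ((1 - 'i) * (E * (rr / A)) + 'i * D)
     = rr * (E * rr * (2 * 'i - 1 - 'i ^+ 2) + A * D * ('i ^+ 2 - 'i)).
    by field.
  have -> : - ((- 'i - 1) * (rr / A) * (E * ((- 'i - 1) * (rr / A)) + D) * (-1
    * A ^+ 2))
     = rr * (E * rr * ('i ^+ 2 + 2 * 'i + 1) + A * D * (- 'i - 1)) by field.
  by rewrite i2; ring.
(* The second relation plus ['i] times the first is free of [D], the conjugate of [d]. *)
apply: (mulfI addi1_neq0).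
have -> : ('i + 1) * d = ('i - 1) * (e * A) + d + 'i * (- (2 * (e * A)) + d)
    + (1 + 'i) * (e * A) by ring.
by rewrite -e1 -e2; ring.
Qed.

(** By [tangent_simple_zero], [d] is twice the real part of [e * (a - c)] and also of
    [e * (a - c')]. As the latter is [t] times the former, [d = t * d]. *)
Lemma tangent_two_circles c rr c' rr' a t e d : rr != 0 -> rr' != 0 ->
  on_circle c rr a -> on_circle c' rr' a ->
  c' - a = t * (c - a) -> t^* = t -> t != 1 ->
  tangent c rr (fun x => (x - a) * (e * (x - a) + d)) ->
  tangent c' rr' (fun x => (x - a) * (e * (x - a) + d)) -> d = 0.
Proof.
move=> r0 r0' ha ha' ct tr t1 /(tangent_simple_zero r0 ha) d1.
move=> /(tangent_simple_zero r0' ha').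
have -> : a - c' = t * (a - c) by rewrite -[LHS]opprB ct; ring.
rewrite mulrCA rmorphM /= tr -mulrDr -d1 => /eqP.
by rewrite -{1}[d]mul1r -subr_eq0 -mulrBl mulf_eq0 subr_eq0 eq_sym (negbTE t1)
  => /eqP.
Qed.

(** The reflection of [a] in the line of centres lies on both circles, so it is [a]: the point of
    contact is collinear with the centres. *)
Lemma touching_centers c rr c' rr' a : rr != 0 ->
  on_circle c rr a -> on_circle c' rr' a ->
  (forall x, on_circle c rr x -> on_circle c' rr' x -> x = a) ->
  exists t, [/\ c' - a = t * (c - a), t^* = t & t != 1].
Proof.
move=> r0 ha ha' uniq; have [a0 ac] := on_circle_conj r0 ha.
(* Circles with equal centres through [a] would coincide, and the antipode of [a] would be a second
   common point. *)
have d0 : c' - c != 0.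
  apply/eqP=> /eqP; rewrite subr_eq0 => /eqP e; subst c'.
  have h x : on_circle c rr x -> on_circle c rr' x
    by rewrite /on_circle -ha' ha.
  have opp := on_circle_opp ha; move: (antipode_neq a0).
  by rewrite (uniq _ opp (h _ opp)) eqxx.
have A0 : (a - c)^* != 0 by rewrite conjC_eq0.
have D0 : (c' - c)^* != 0 by rewrite conjC_eq0.
(* The left-hand side is the reflection of [a] in the line through [c] and [c']. *)
have refl : c + (a - c)^* * (c' - c) / (c' - c)^* = a.
  apply: uniq; rewrite /on_circle.
    rewrite addrC addKr -ha !(rmorphM, fmorphV) /= !conjCK.
    by field; rewrite -rmorphB D0 d0.
  rewrite -ha'.
  have -> : a - c' = (a - c) - (c' - c) by ring.
  rewrite (_ : c + _ - c' = (a - c)^* * (c' - c) / (c' - c)^* - (c' - c));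
    last by ring.
  rewrite !(rmorphB, rmorphM, fmorphV) /= !conjCK.
  move: d0 D0; rewrite !rmorphB /= => d0 D0.
  by field; rewrite D0 d0.
have {}refl : (a - c)^* * (c' - c) = (a - c) * (c' - c)^*.
  by rewrite -{2}refl [c + _]addrC addrK mulfVK.
exists (1 - (c' - c) / (a - c)); split.
- by field.
- rewrite !(rmorphB _ 1, rmorphM, fmorphV) /= conjC1; congr (1 - _).
  apply: (mulfI (mulf_neq0 a0 A0)).
  transitivity ((a - c) * (c' - c)^*); first by field; rewrite -rmorphB.
  by rewrite -refl; field.
- rewrite -subr_eq0 (_ : _ - 1 = - ((c' - c) / (a - c))); last by ring.
  by rewrite oppr_eq0 mulf_neq0 ?invr_eq0.
Qed.

(* The inversion in 0 sends the circle with centre [c2], touching in [k] the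
   circle of centre [c] through 0, to a circle with centre
   [c2^* / (|c2|^2 - r2)]; its radius at [k^-1] is orthogonal to the image line
   of the latter circle. *)
Lemma inverted_center c k s : c != 0 -> k != 0 -> s^* = s -> s != 1 ->
  k * k^* = c^* * k + c * k^* ->
  let c2 := k + s * (c - k) in
  exists p, p^* = p /\
    k^-1 - c2^* / (c2 * c2^* - s ^+ 2 * (c * c^*)) = p * c^*.
Proof.
move=> c0 k0 sr s1 kk; have K0 : k^* != 0 by rewrite conjC_eq0.
have s1' : 1 - s != 0 by rewrite subr_eq0 eq_sym.
exists (- s / (k * k^* * (1 - s))); split.
  by rewrite !(rmorphM, rmorphN, fmorphV,
    rmorphB) /= conjC1 sr conjCK [k^* * k]mulrC.
have -> : (k + s * (c - k)) * (k + s * (c - k))^* - s ^+ 2 * (c * c^*) = k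
  * k^* * (1 - s).
  rewrite !(rmorphD, rmorphM, rmorphB) /= sr.
  transitivity (k * k^* * (1 - s *+ 2 + s ^+ 2) + (s - s ^+ 2) * (c^* * k + c
    * k^*)); first by ring.
  by rewrite -kk; ring.
by rewrite !(rmorphD, rmorphM, rmorphB) /= sr; field; rewrite k0 K0 s1'.
Qed.

(* Inversion at the common point [a] of two of three touching circles turns
   these two into parallel lines, and the third into a circle touching both:
   the chord between its points of contact is their common normal. *)
Lemma inverted_chord c rr c' rr' c2 r2 a k k' t s s' :
  rr != 0 -> rr' != 0 -> t != 1 -> s != 1 -> s' != 1 ->
  t^* = t -> s^* = s -> s'^* = s' ->
  on_circle c rr a -> on_circle c' rr' a -> on_circle c rr k ->
  on_circle c' rr' k' -> on_circle c2 r2 k -> on_circle c2 r2 k' ->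
  c' - a = t * (c - a) -> c2 - k = s * (c - k) -> c2 - k' = s' * (c' - k') ->
  k != a -> k' != a ->
  (k - a)^-1 - (k' - a)^-1 = ((c - a)^-1 - (c' - a)^-1) / 2.
Proof.
move=> r0 r0' t1 s1 s1' tr sr sr' /[dup] /(on_circle_conj r0)[a0 ac] ha.
move=> /[dup] /(on_circle_conj r0')[a0' ac'] ha'.
rewrite /on_circle => hk hk' h2k h2k' et es es' ka ka'.
rewrite -subr_eq0 in ka; rewrite -subr_eq0 in ka'.
have c0 : c - a != 0 by rewrite -oppr_eq0 opprB.
have c0' : c' - a != 0 by rewrite -oppr_eq0 opprB.
have t0 : t != 0 by apply: contra c0' => /eqP z; rewrite et z mul0r.
have sh x y : x - y = (x - a) - (y - a) by ring.
have rC : rr = (c - a) * (c - a)^*.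
  by rewrite -ha -[a - c]opprB rmorphN /= mulrNN.
have rC' : rr' = (c' - a) * (c' - a)^*.
  by rewrite -ha' -[a - c']opprB rmorphN /= mulrNN.
have r2e : r2 = s ^+ 2 * ((c - a) * (c - a)^*).
  rewrite -rC -hk -h2k -[k - c2]opprB es -[k - c]opprB.
  by rewrite !(rmorphN, rmorphM) /= sr; ring.
have r2e' : r2 = s' ^+ 2 * ((c' - a) * (c' - a)^*).
  rewrite -rC' -hk' -h2k' -[k' - c2]opprB es' -[k' - c']opprB.
  by rewrite !(rmorphN, rmorphM) /= sr'; ring.
have kk x d : (x - d) * (x - d)^* = (d - a) * (d - a)^* ->
    (x - a) * (x - a)^* = (d - a)^* * (x - a) + (d - a) * (x - a)^*.
  rewrite (sh x d) rmorphB /=; move: (x - a) (d - a) => X D h.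
  transitivity ((X - D) * (X^* - D^*) - D * D^* + D^* * X + D * X^*);
    first by ring.
  by rewrite h subrr add0r.
have {ha hk}kk1 := kk k c (etrans hk rC).
have {ha' hk' kk}kk2 := kk k' c' (etrans hk' rC').
have e2 : c2 - a = k - a + s * (c - a - (k - a)) by rewrite -sh -es; ring.
have e2' : c2 - a = k' - a + s' * (c' - a - (k' - a)) by rewrite -sh -es'; ring.
have [p [pr]] := inverted_center c0 ka sr s1 kk1.
have [p' [pr']] := inverted_center c0' ka' sr' s1' kk2.
rewrite /= -e2 -e2' -r2e -r2e' et.
move: kk2; rewrite et.
move: (c2 - a) (c - a) (k - a) (k' - a) c0 ka ka' kk1
  => W C X Y C0 X0 Y0 kk1 kk2 e' e.
rewrite rmorphM /= tr in e' kk2.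
(* [C^*] is normal to both image lines. By [inverted_center] the centre of the third image circle
   differs from each point of contact by a real multiple of it, the second centre being [t * C]. *)
have n : X^-1 - Y^-1 = (p - p' * t) * C^*.
  rewrite mulrBl -mulrA -e -e'; ring.
have XC0 : X^* != 0 by rewrite conjC_eq0.
have YC0 : Y^* != 0 by rewrite conjC_eq0.
have CC0 : C^* != 0 by rewrite conjC_eq0.
(* The inverted points lie on the image lines, where the real part of [C * w] is 1/2 and [t^-1 / 2];
   this fixes the multiple of the normal. *)
have f1 : C / X + C^* / X^* = 1.
  apply: (mulfI (mulf_neq0 X0 XC0)); rewrite mulr1 [RHS]kk1; field;
    by rewrite X0 XC0.
have f2 : C / Y + C^* / Y^* = t^-1.
  apply: (mulfI (mulf_neq0 t0 (mulf_neq0 Y0 YC0)));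
    rewrite [RHS]mulrAC mulfV // mul1r [RHS]kk2.
  by field; rewrite Y0 YC0.
have v : (p - p' * t) * (C * C^*) * 2 = 1 - t^-1.
  transitivity (C / X + C^* / X^* - (C / Y + C^* / Y^*)); last by rewrite f1 f2.
  have := congr1 (fun x => x^*) n; rewrite !(rmorphB, rmorphM,
    fmorphV) /= pr pr' tr conjCK => n'.
  transitivity (C * (X^-1 - Y^-1) + C^* * (X^*^-1 - Y^*^-1)); last by ring.
  by rewrite n n'; ring.
have two : 2 != 0 :> K by rewrite pnatr_eq0.
rewrite n; apply: (mulfI (mulf_neq0 C0 two)).
transitivity ((p - p' * t) * (C * C^*) * 2); first by ring.
by rewrite v; field; rewrite C0 t0.
Qed.

Lemma inv_omega a k m : k != a -> m != a -> m != k ->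
  ((k - a) * (m - a) / (m - k))^-1 = (k - a)^-1 - (m - a)^-1.
Proof.
rewrite -(subr_eq0 k) -(subr_eq0 m a) -(subr_eq0 m k) => k0 m0 mk.
by field; rewrite ?k0 ?m0 ?mk.
Qed.
End Circles.

(** * Quadratic polynomials *)

Section Quadratics.
Variable R : realType.
Local Notation C := R[i].
Implicit Types (k : 'cV[C]_3) (a b x : C).

Definition coef2 k : C := (k ord0 ord0 - 'i%C * k (@Ordinal 3 1 isT) ord0) / 2.
Definition coef1 k : C := - k (@Ordinal 3 2 isT) ord0.
Definition coef0 k : C := (- k ord0 ord0 - 'i%C * k
  (@Ordinal 3 1 isT) ord0) / 2.

(* The vectors of C^3 as quadratic polynomials, in such a way that the edge
   vectors of both Weierstrass formulas become [(x - a) * (x - b)]. *)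
Definition quad k x := coef2 k * x ^+ 2 + coef1 k * x + coef0 k.

Definition chord a b := vec3 (1 - a * b) ('i%C * (1 + a * b)) (a + b).

Let sqri : 'i%C ^+ 2 = -1 :> C. Proof. exact: sqr_i. Qed.
Let two : 2 != 0 :> C. Proof. by rewrite pnatr_eq0. Qed.

Lemma quad_coefD k k' :
  [/\ coef2 (k + k') = coef2 k + coef2 k', coef1 (k + k') = coef1 k + coef1 k'
    & coef0 (k + k') = coef0 k + coef0 k'].
Proof. by rewrite /coef2 /coef1 /coef0 !mxE; split; field. Qed.

Lemma quad_coefZ e k :
  [/\ coef2 (e *: k) = e * coef2 k, coef1 (e *: k) = e * coef1 k
    & coef0 (e *: k) = e * coef0 k].
Proof. by rewrite /coef2 /coef1 /coef0 !mxE; split; field. Qed.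

Lemma quad_coef_chord a b :
  [/\ coef2 (chord a b) = 1, coef1 (chord a b) = - (a + b)
    & coef0 (chord a b) = a * b].
Proof.
rewrite /coef2 /coef1 /coef0 !mxE /=; split=> //.
  by rewrite mulrA -expr2 sqri; field.
by rewrite mulrA -expr2 sqri; field.
Qed.

Lemma quad_coef_eq0 k : coef2 k = 0 -> coef1 k = 0 -> coef0 k = 0 -> k = 0.
Proof.
rewrite /coef2 /coef1 /coef0 => h2 h1 h0.
have k0 : k ord0 ord0 = 0.
  rewrite [LHS](_ : _ = (k ord0 ord0 - 'i%C * k (@Ordinal 3 1 isT) ord0) / 2
    - (- k ord0 ord0 - 'i%C * k (@Ordinal 3 1 isT) ord0) / 2); last by field.
  by rewrite h2 h0 subrr.
have k1 : k (@Ordinal 3 1 isT) ord0 = 0.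
  transitivity ('i%C * ((k ord0 ord0 - 'i%C * k (@Ordinal 3 1 isT) ord0) / 2
    + (- k ord0 ord0 - 'i%C * k (@Ordinal 3 1 isT) ord0) / 2)); last first.
    by rewrite h2 h0 addr0 mulr0.
  transitivity (- ('i%C ^+ 2) * k (@Ordinal 3 1 isT) ord0); last by field.
  by rewrite sqri opprK mul1r.
have k2 : k (@Ordinal 3 2 isT) ord0 = 0 by apply: oppr_inj; rewrite h1 oppr0.
apply/colP=> -[[|[|[|//]]] lt]; rewrite mxE.
- by rewrite -[RHS]k0; congr (k _ _); apply: val_inj.
- by rewrite -[RHS]k1; congr (k _ _); apply: val_inj.
- by rewrite -[RHS]k2; congr (k _ _); apply: val_inj.
Qed.

Lemma quadD k k' x : quad (k + k') x = quad k x + quad k' x.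
Proof. by have [h2 h1 h0] := quad_coefD k k'; rewrite /quad h2 h1 h0; ring. Qed.

Lemma quadZ e k x : quad (e *: k) x = e * quad k x.
Proof. by have [h2 h1 h0] := quad_coefZ e k; rewrite /quad h2 h1 h0; ring. Qed.

Lemma quad0 x : quad 0 x = 0.
Proof. by rewrite -(scale0r 0) quadZ mul0r. Qed.

Lemma quadN k x : quad (- k) x = - quad k x.
Proof. by rewrite -scaleN1r quadZ mulN1r. Qed.

Lemma quadB k k' x : quad (k - k') x = quad k x - quad k' x.
Proof. by rewrite quadD quadN. Qed.

Lemma quad_sum I (r : seq I) (P : pred I) (F : I -> 'cV[C]_3) x :
  quad (\sum_(i <- r | P i) F i) x = \sum_(i <- r | P i) quad (F i) x.
Proof. by apply: (big_morph (quad^~ x)) => [k k'|]; rewrite ?quadD ?quad0. Qed.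

Lemma quad_coef_sum I (r : seq I) (P : pred I) (F : I -> 'cV[C]_3) :
  let s := \sum_(i <- r | P i) F i in
  [/\ coef2 s = \sum_(i <- r | P i) coef2 (F i),
      coef1 s = \sum_(i <- r | P i) coef1 (F i)
    & coef0 s = \sum_(i <- r | P i) coef0 (F i)].
Proof.
have z := quad_coefZ 0 0; rewrite scale0r !mul0r in z; case: z => z2 z1 z0.
by split; apply: big_morph => // k k'; case: (quad_coefD k k').
Qed.

Lemma quad_chord a b x : quad (chord a b) x = (x - a) * (x - b).
Proof. by have [h2 h1 h0] := quad_coef_chord a b; rewrite /quad h2 h1 h0;
  ring. Qed.

Lemma quad_root k a x : quad k a = 0 ->
  quad k x = (x - a) * (coef2 k * (x - a) + (2 * coef2 k * a + coef1 k)).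
Proof.
move=> h; rewrite -[LHS]subr0 -h /quad; ring.
Qed.

Lemma quad_factor k a b : quad k a = 0 -> coef1 k = - coef2 k * (a + b) ->
  k = coef2 k *: chord a b.
Proof.
move=> ka c1; apply/eqP; rewrite -subr_eq0; apply/eqP.
have [g2 g1 g0] := quad_coefD k (- (coef2 k *: chord a b)).
have [f2 f1 f0] := quad_coefZ (- coef2 k) (chord a b).
have [e2 e1 e0] := quad_coef_chord a b.
rewrite scaleNr e2 e1 e0 in f2 f1 f0.
apply: quad_coef_eq0; rewrite ?g2 ?g1 ?g0 ?f2 ?f1 ?f0.
- by rewrite mulr1 subrr.
- by rewrite c1; ring.
- by rewrite -ka /quad c1; ring.
Qed.

Lemma quad_root2 k a b : a != b -> quad k a = 0 -> quad k b = 0 ->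
  k = coef2 k *: chord a b.
Proof.
move=> ab ka; rewrite (quad_root b ka) => /eqP.
rewrite mulf_eq0 subr_eq0 eq_sym (negbTE ab) /= => /eqP h1.
apply: quad_factor => //.
by apply/eqP; rewrite -subr_eq0 -h1; apply/eqP; ring.
Qed.

Lemma quad_root3 k a b d : a != b -> b != d -> d != a ->
  quad k a = 0 -> quad k b = 0 -> quad k d = 0 -> k = 0.
Proof.
move=> ab bd da ka kb; rewrite {1}(quad_root2 ab ka kb) quadZ quad_chord
  => /eqP.
rewrite mulf_eq0 => /orP[/eqP e|]; first by rewrite
  (quad_root2 ab ka kb) e scale0r.
by rewrite mulf_eq0 !subr_eq0 (negbTE da) eq_sym (negbTE bd).
Qed.

Lemma quad_interp a b d p q r : a != b -> b != d -> d != a ->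
  exists k, [/\ quad k a = p, quad k b = q & quad k d = r].
Proof.
rewrite -(subr_eq0 a) -(subr_eq0 b) -(subr_eq0 d) => ab bd da.
have ba : b - a != 0 by rewrite -oppr_eq0 opprB.
have db : d - b != 0 by rewrite -oppr_eq0 opprB.
have ad : a - d != 0 by rewrite -oppr_eq0 opprB.
(* Lagrange interpolation, since [chord b d] is the polynomial [(x - b) * (x - d)]. *)
exists ((p / ((a - b) * (a - d))) *: chord b d
  + (q / ((b - a) * (b - d))) *: chord a d
  + (r / ((d - a) * (d - b))) *: chord a b).
by split; rewrite !quadD !quadZ !quad_chord; field;
  rewrite ?ab ?ba ?bd ?db ?ad ?da.
Qed.

(** Comparison of coefficients: it translates closedness of the edge vectors into the scalar
    equations of both types of differentials. *)
Lemma sum_chord_eq0 (I : finType) (P : pred I) (e a b : I -> C) :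
  \sum_(i | P i) e i *: chord (a i) (b i) = 0 <->
  [/\ \sum_(i | P i) e i = 0, \sum_(i | P i) e i * (a i + b i) = 0
    & \sum_(i | P i) e i * (a i * b i) = 0].
Proof.
have [s2 s1 s0] := quad_coef_sum (index_enum I) P (fun i => e i *: chord (a i)
  (b i)).
have E2 i : coef2 (e i *: chord (a i) (b i)) = e i.
  by have [-> _ _] := quad_coefZ (e i) (chord (a i) (b i)); have [-> _ _] :=
    quad_coef_chord (a i) (b i); rewrite mulr1.
have E1 i : coef1 (e i *: chord (a i) (b i)) = - (e i * (a i + b i)).
  by have [_ -> _] := quad_coefZ (e i) (chord (a i) (b i)); have [_ -> _] :=
    quad_coef_chord (a i) (b i); rewrite mulrN.
have E0 i : coef0 (e i *: chord (a i) (b i)) = e i * (a i * b i).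
  by have [_ _ ->] := quad_coefZ (e i) (chord (a i) (b i)); have [_ _ ->] :=
    quad_coef_chord (a i) (b i).
rewrite (eq_bigr _ (fun i _ => E2 i)) in s2.
rewrite (eq_bigr _ (fun i _ => E1 i)) sumrN in s1.
rewrite (eq_bigr _ (fun i _ => E0 i)) in s0.
have z := quad_coefZ 0 0; rewrite scale0r !mul0r in z; case: z => z2 z1 z0.
split=> [h|[h2 h1 h0]]; last by apply: quad_coef_eq0;
  rewrite ?s2 ?s1 ?s0 ?h1 ?oppr0.
by move: s2 s1 s0; rewrite h z2 z1 z0 => <- /esym/eqP;
  rewrite oppr_eq0 => /eqP -> <-.
Qed.

Lemma koebe_chord a :
  vec3 (1 - a ^+ 2) ('i%C * (1 + a ^+ 2)) (2 * a) = chord a a.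
Proof. by rewrite /chord expr2 mulr_natl mulr2n. Qed.

Lemma conj_realP (x : C) : x^* = x -> (complex.Re x)%:C%C = x.
Proof. by move/CrealP/RRe_real. Qed.

Lemma conj_real (x : R) : (x%:C%C)^* = x%:C%C.
Proof. exact: conjc_real. Qed.
End Quadratics.

(** * Medial triangulations *)

Section Medial.
Variables (V : finType) (G : V -> V -> V -> bool).
Hypothesis hG : triangulated_disk G.
Variable T : {set V} -> {set V} -> {set V} -> bool.
Hypothesis hT : medial_triangulation G T.
Let dT : triangulated_disk T := medial_disk hT.

Lemma medial_edges i j k : T i j k -> i \in edges G.
Proof. by move=> /face_edge/edge_vertex; rewrite (medial_vertices hT). Qed.

(** [medial_polygons] identifies a medial triangle only as a set. Its orientation follows because
    [T] contains the medial triangle with the orientation of [G], hence not the reversed one. *)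
Lemma medial_cases i j k : T i j k ->
  (exists a b c, [/\ G a b c, i = [set a; b], j = [set b; c] & k = [set c; a]])
  \/ (exists u, [/\ u \in i, u \in j & u \in k]).
Proof.
move=> h; have [[u [v [s [g e]]]]|] := medial_polygons hT h; last by right.
left; have t := medial_faces hT g.
have rev A B D : T A B D -> ~~ T A D B.
  by move=> /(face_rot2 dT)/(face_or dT).
have gv := face_rot hG g; have gs := face_rot hG gv.
have ij := face_neq dT h; have jk := face_neq dT (face_rot dT h).
have ki := face_neq dT (face_rot2 dT h).
have hi : i \in [set i; j; k] by rewrite !inE eqxx.
have hj : j \in [set i; j; k] by rewrite !inE eqxx orbT.
have hk : k \in [set i; j; k] by rewrite !inE eqxx orbT.
have := rev _ _ _ t; have := rev _ _ _ (face_rot dT t).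
have := rev _ _ _ (face_rot2 dT t).
rewrite e !inE in hi hj hk.
(* Of the 27 assignments, those with a repetition or with the reversed order are contradictory; the
   three rotations remain. *)
case/orP: hi => [/orP[]|] /eqP ei; case/orP: hj => [/orP[]|] /eqP ej;
  case/orP: hk => [/orP[]|] /eqP ek; subst i j k;
  rewrite ?eqxx // ?h // in ij jk ki *; move=> _ _ _.
- by exists u, v, s.
- by exists v, s, u.
- by exists s, u, v.
Qed.

Lemma edge_at i u : i \in edges G -> u \in i ->
  exists2 a, edge G u a & i = [set u; a].
Proof.
move=> /edgesP[a [b [-> h]]]; rewrite !inE => /orP[] /eqP ->; first by exists b.
by exists a; rewrite 1?edgeC // finset.setUC.
Qed.

Lemma edge_at2 i u w : i \in edges G -> u \in i -> w \in i -> u != w ->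
  i = [set u; w].
Proof.
move=> hi /(edge_at hi)[a _ ->]; rewrite !inE => /orP[] /eqP -> //.
by rewrite eqxx.
Qed.

Lemma edges_share i j u w : i \in edges G -> j \in edges G -> i != j ->
  u \in i -> u \in j -> w \in i -> w \in j -> u = w.
Proof.
move=> hi hj ij ui uj wi wj; apply/eqP/negPn/negP => uw.
by move: ij; rewrite (edge_at2 hi ui wi uw) (edge_at2 hj uj wj uw) eqxx.
Qed.

Lemma medial_common i j k : T i j k -> exists u, u \in i /\ u \in j.
Proof.
case/medial_cases=> [[a [b [c [_ -> -> _]]]]|[u []]]; last by exists u.
by exists b; rewrite set21 set22.
Qed.

(** Sides of medial triangles and diagonals of polygons alike join two points on one circle. This
    makes [packing_neq] and the chord lemmas available on every edge of [T]. *)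
Lemma medial_adjacent i j : edge T i j -> exists u a b,
  [/\ i = [set u; a], j = [set u; b], edge G u a, edge G u b & a != b].
Proof.
move=> h; have nij := edge_neq dT h.
have hi : i \in edges G by rewrite -(medial_vertices hT); apply: edge_vertex h.
have hj : j \in edges G.
  by rewrite -(medial_vertices hT); rewrite edgeC in h; apply: edge_vertex h.
have [u [ui uj]] : exists u, u \in i /\ u \in j.
  case/edge_face: h => k [] /medial_common[u [ui uj]]; by exists u.
have [a ea ei] := edge_at hi ui; have [b eb ej] := edge_at hj uj.
exists u, a, b; split=> //; by apply: contra nij => /eqP ab; rewrite ei ej ab.
Qed.

Lemma medial_at_edge i : i \in edges G -> exists u v s,
  [/\ G u v s, i = [set u; v] & T i [set v; s] [set s; u]].
Proof.
move=> /edgesP[u [v [-> /edge_face[s [] g]]]].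
  by exists u, v, s; split=> //; apply: medial_faces g.
exists v, u, s; split=> //; first exact: finset.setUC.
by rewrite [X in T X]finset.setUC; apply: (medial_faces hT).
Qed.

(** The right-hand side depends on the face only as a set, so a function on faces of [T] can be read
    as one on faces of [G]. *)
Lemma medial_faceE a b c : G a b c -> medial_face a b c =
  [set e in edges G | e \subset [set a; b; c]].
Proof.
move=> g; apply/setP=> e; rewrite !inE; apply/orP/andP.
  have gb := face_rot hG g; have gc := face_rot hG gb.
  move=> [/orP[]|] /eqP ->; rewrite mem_edges ?(face_edge g) ?(face_edge gb)
    ?(face_edge gc) //;
  by split=> //; apply/fintype.subsetP=> x; rewrite !inE; do 2?[case/orP];
    move=> /eqP ->; rewrite eqxx ?orbT.
case=> /edgesP[x [y [-> /(edge_neq hG) xy]]] /fintype.subsetP sub.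
have := sub x (set21 x y); have := sub y (set22 x y); rewrite !inE.
have C p q : ([set p; q] == [set q; p]) by rewrite finset.setUC.
by move=> /orP[/orP[]|] /eqP ey /orP[/orP[]|] /eqP ex; subst x y;
  rewrite ?eqxx // in xy *; rewrite ?C ?orbT; auto.
Qed.

Section Jump.
Variable M : zmodType.

(* Among the triangles of [T] at the point of the edge {u, v}, only the two
   medial ones have one neighbour of that point on the circle of u and the
   other one on the circle of v. *)
Lemma medial_jump (F : {set {set V}} -> M) u v s t : G u v s -> G v u t ->
  \sum_(j | edge T [set u; v] j && (u \in j))
    (F (left_face T [set u; v] j) - F (right_face T [set u; v] j)) =
  F (medial_face v u t) - F (medial_face u v s).
Proof.
move=> gs gt; set i := [set u; v].
have hi : i \in int_vertices T.
  by rewrite (medial_int_vertices hT) (mem_int_edges G); apply/int_edgeP;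
    exists s, t.
have nuv := face_neq hG gs.
have nus : u != s by rewrite eq_sym; apply: (face_neq hG (face_rot2 hG gs)).
have nvt : v != t by rewrite eq_sym; apply: (face_neq hG (face_rot2 hG gt)).
have Tt := medial_faces hT gt; rewrite (finset.setUC [set v]) -/i in Tt.
have Ts := medial_faces hT gs; rewrite -/i in Ts.
rewrite (sum_jump dT F (fun j => u \in j) hi).
have n01 : ([set v; s], [set s; u]) != ([set u; t], [set t; v]).
  apply/eqP=> -[e _]; have := set21 u t; rewrite -e !inE.
  by rewrite (negbTE nuv) (negbTE nus).
rewrite (bigD1 ([set u; t], [set t; v])) //= (bigD1 ([set v; s],
  [set s; u])) /=; last first.
  by rewrite Ts n01.
rewrite big1 ?addr0 => [|[j k] /= /andP[/andP[Tj n1] n2]]; last first.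
  (* Apart from the two medial triangles, a triangle at [i] has all its points on the circle of [u]
     or all on that of [v]. So [u] lies in both or neither of [j] and [k], and its terms cancel. *)
  have ij := face_neq dT Tj; have ki := face_neq dT (face_rot2 dT Tj).
  have hie := medial_edges Tj; have hje := medial_edges (face_rot dT Tj).
  have hke := medial_edges (face_rot2 dT Tj).
  case: (medial_cases Tj) => [[a [b [c [g /set2_inj[[ea eb]|[ea eb]] ej
    ek]]]]|].
  - subst a b; move: n2; rewrite ej ek (face_inj hG g gs) eqxx //.
  - subst a b; move: n1; rewrite ej ek (face_inj hG g gt) eqxx //.
  - move=> [w [wi wj wk]]; have := wi; rewrite !inE => /orP[] /eqP ew; subst w.
      by rewrite wj wk subrr.
    have -> : (u \in j) = false.
      by apply/negP=> uj; move: nuv; rewrite (edges_share hie hje ij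
        (set21 u v) uj wi wj) eqxx.
    have -> : (u \in k) = false.
      rewrite eq_sym in ki.
      by apply/negP=> uk; move: nuv; rewrite (edges_share hie hke ki
        (set21 u v) uk wi wk) eqxx.
    by rewrite !mulr0n subrr.
rewrite !inE !eqxx ?(negbTE nuv) ?(negbTE nvt) ?(negbTE nus) ?orbT /= ?mulr1n.
have -> : (u == t) = false by apply/negbTE;
  apply: (face_neq hG (face_rot hG gt)).
by rewrite /= mulr0n subr0 mulr0n sub0r /medial_face
  (finset.setUC [set v] [set u]).
Qed.
End Jump.
End Medial.

(** Differentials live on unordered edges, whereas jumps give values on oriented ones. The default 0
    is the required extension by zero. *)
Lemma symmetric_edge_function (R : zmodType) (V : finType)
    (G : V -> V -> V -> bool) (g : V -> V -> R) :
  (forall u v, int_edge G u v -> g v u = g u v) ->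
  exists l : {ffun {set V} -> R},
    (forall e, e \notin int_edges G -> l e = 0) /\
    (forall u v, int_edge G u v -> l [set u; v] = g u v).
Proof.
move=> sym; pose val (e : {set V}) : R :=
  if [pick p : V * V | int_edge G p.1 p.2 && (e == [set p.1; p.2])] is Some p
  then g p.1 p.2 else 0.
exists [ffun e => val e]; split=> [e he|u v huv]; rewrite ffunE /val;
  case: pickP => //=.
  move=> [a b] /= /andP[h /eqP e']; case/negP: he; rewrite e'.
  by rewrite (mem_int_edges G).
- move=> [a b] /= /andP[_ /eqP/set2_inj[] [eu ev]]; rewrite -eu -ev //.
  by rewrite sym.
- by move=> /(_ (u, v)); rewrite /= huv eqxx.
Qed.

(** The difference of the two realizations has no jumps, so [face_propagate] makes it constant. *)
Lemma realization_unique (R : realType) (V : finType) (G : V -> V -> V -> bool)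
    (F F' : {set V} -> 'cV[R[i]]_3) : triangulated_disk G ->
  (forall u v, int_edge G u v ->
     F' (left_face G u v) - F' (right_face G u v) =
     F (left_face G u v) - F (right_face G u v)) ->
  exists t, forall f, f \in faces G -> F' f = F f + t.
Proof.
move=> hG h; have [f0 hf0] := faces_nonempty hG; exists (F' f0 - F f0) => f hf.
suff <- : F' f - F f = F' f0 - F f0 by rewrite addrC subrK.
apply: (@face_propagate _ _ hG (fun f => F' f - F f = F' f0 - F f0) _ f0 f)
  => //.
move=> u v /h e; suff -> : F' (left_face G u v) - F (left_face G u v) =
  F' (right_face G u v) - F (right_face G u v) by [].
have -> : F' (left_face G u v) = F (left_face G u v) - F (right_face G u v)
  + F' (right_face G u v).
  by rewrite -e subrK.
by rewrite -[_ - _ + _]addrA addrAC subrr add0r addrC.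
Qed.

(** * The correspondence *)

Section Packing.
Variables (R : realType) (V : finType) (G : V -> V -> V -> bool).
Hypothesis hG : triangulated_disk G.
Local Notation C := R[i].
Variables (circ : V -> set C) (z : {set V} -> C).
Hypothesis hz : circle_packing G circ z.

(** * Centres, tangency points and the function omega of a packing *)

Lemma packing_centers : exists c rr : V -> C, forall u, u \in vertices G ->
  rr u != 0 /\ forall x, circ u x <-> on_circle (c u) (rr u) x.
Proof.
have /boolp.choice[p hp] : forall u, exists p : C * C, u \in vertices G ->
    p.2 != 0 /\ forall x, circ u x <-> on_circle p.1 p.2 x.
  move=> u; have [hu|nu] := boolP (u \in vertices G); last by exists (0, 0).
  have [c [r [r0 e]]] := packing_circle hz hu; exists (c, r%:C%C ^+ 2) => _ /=.
  have rC0 : 0 < r%:C%C :> C by rewrite ltcR.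
  split; first by rewrite expf_neq0 // gt_eqF.
  move=> x; rewrite e /on_circle -normCK /=; split=> [->//|h].
  by apply: (pexpIrn (isT : (0 < 2)%N)) => //; rewrite nnegrE ?normr_ge0 // ltW.
by exists (fun u => (p u).1), (fun u => (p u).2).
Qed.

Variables c rr : V -> C.
Hypothesis rr0 : forall u, u \in vertices G -> rr u != 0.
Hypothesis circE : forall u, u \in vertices G ->
  forall x, circ u x <-> on_circle (c u) (rr u) x.

Lemma rr_neq0 u v : edge G u v -> rr u != 0.
Proof. by move=> /edge_vertex/rr0. Qed.

Lemma touch_left u v : edge G u v -> on_circle (c u) (rr u) (z [set u; v]).
Proof.
move=> h; apply/(circE (edge_vertex h)).
by have : [set z [set u; v]]%classic (z [set u; v]) by [];
  rewrite -(packing_touch hz h) => -[].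
Qed.

Lemma touch_right u v : edge G u v -> on_circle (c u) (rr u) (z [set v; u]).
Proof. by rewrite finset.setUC; apply: touch_left. Qed.

Lemma touch_centers u v : edge G u v -> exists t,
  [/\ c v - z [set u; v] = t * (c u - z [set u; v]), t^* = t & t != 1].
Proof.
move=> h; have h' : edge G v u by rewrite edgeC.
apply: (touching_centers (rr_neq0 h) (touch_left h) (touch_right h'))
  => x hu hv.
have : (circ u `&` circ v)%classic x.
  by split; [apply/(circE (edge_vertex h))|apply/(circE (edge_vertex h'))].
by rewrite (packing_touch hz h).
Qed.

Lemma omegaE u v s t : G u v s -> G v u t ->
  omega G z u v = (z [set s; u] - z [set u; v]) * (z [set t; u] - z [set u; v])
                  / (z [set t; u] - z [set s; u]).
Proof. by move=> gs gt; rewrite /omega (apexE hG gs) (apexE hG gt). Qed.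

Lemma points_neq u v s t : G u v s -> G v u t ->
  [/\ z [set s; u] != z [set u; v], z [set t; u] != z [set u; v]
    & z [set t; u] != z [set s; u]].
Proof.
move=> gs gt; have euv := face_edge gs.
have eus : edge G u s by rewrite (edgeC G) (face_edge (face_rot2 hG gs)).
have eut : edge G u t by rewrite (face_edge (face_rot hG gt)).
have nvs := face_neq hG (face_rot hG gs); have nst := apex_neq hG gs gt.
have ntv := face_neq hG (face_rot2 hG gt).
rewrite ![[set _; u]]finset.setUC; split; apply: (packing_neq hz) => //.
- by rewrite eq_sym.
- by rewrite eq_sym.
Qed.

Lemma inv_omega_face u v s t : G u v s -> G v u t ->
  (omega G z u v)^-1 = (z [set s; u] - z [set u; v])^-1 - (z [set t; u]
    - z [set u; v])^-1.
Proof.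
by move=> gs gt; rewrite (omegaE gs gt); have [] := points_neq gs gt;
  apply: inv_omega.
Qed.

(** The right-hand side is the same for the faces on both sides of the edge; this is what makes
    [omega] antisymmetric. *)
Lemma face_chord u v s : G u v s || G v u s ->
  (z [set s; u] - z [set u; v])^-1 - (z [set s; v] - z [set u; v])^-1 =
  ((c u - z [set u; v])^-1 - (c v - z [set u; v])^-1) / 2.
Proof.
wlog h : u v / G u v s.
  move=> H /orP[h|h]; first by apply: H => //; rewrite h.
  have := H v u h; rewrite h (finset.setUC [set v]) => /(_ isT) e.
  by rewrite -opprB e; ring.
move=> _; have euv := face_edge h; have evs := face_edge (face_rot hG h).
have esu := face_edge (face_rot2 hG h).
have eus : edge G u s by rewrite (edgeC G).
have evu : edge G v u by rewrite (edgeC G).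
have [t [et tr t1]] := touch_centers euv.
have [p [ep pr p1]] := touch_centers eus.
have [q [eq qr q1]] := touch_centers evs.
rewrite ![[set s; _]]finset.setUC.
apply: (inverted_chord (rr_neq0 euv) (rr_neq0 evu) t1 p1 q1 tr pr qr
  (touch_left euv) (touch_right evu) (touch_left eus) (touch_left evs)
  (touch_right _) (touch_right _) et ep eq) => //.
- by rewrite (edgeC G).
- by apply: (packing_neq hz) => //; rewrite eq_sym (face_neq hG
  (face_rot hG h)).
- rewrite (finset.setUC [set u]); apply: (packing_neq hz) => //.
  by apply: (face_neq hG (face_rot2 hG h)).
Qed.

(** The sum of the two inverses is the difference of two instances of [face_chord], one for each
    face at the edge. *)
Lemma omega_antisym u v : int_edge G u v ->
  (omega G z v u)^-1 = - (omega G z u v)^-1.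
Proof.
case/int_edgeP=> s [t [gs gt]].
rewrite (inv_omega_face gt gs) (inv_omega_face gs gt) (finset.setUC [set v]).
have es : G u v s || G v u s by rewrite gs.
have et : G u v t || G v u t by rewrite gt orbT.
have /eqP := etrans (face_chord es) (esym (face_chord et)).
rewrite -subr_eq0 => /eqP h; apply/eqP; rewrite -subr_eq0 -h; apply/eqP; ring.
Qed.

Lemma omega_neq0 u v : int_edge G u v -> omega G z u v != 0.
Proof.
case/int_edgeP=> s [t [gs gt]]; rewrite (omegaE gs gt).
have [h1 h2 h3] := points_neq gs gt.
by rewrite !mulf_neq0 ?invr_eq0 ?subr_eq0.
Qed.

(** * Edge vectors tangent to the circle of a vertex, and realizations of Koebe type *)

Definition tangent_at u (k : 'cV[C]_3) := tangent (c u) (rr u) (quad k).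

Lemma tangent_atD u k k' : tangent_at u k -> tangent_at u k' ->
  tangent_at u (k + k').
Proof. by move=> h h'; apply: tangent_ext (tangentD h h') => x;
  rewrite quadD. Qed.

Lemma tangent_atN u k : tangent_at u k -> tangent_at u (- k).
Proof. by move=> h; apply: tangent_ext (tangentN h) => x; rewrite quadN. Qed.

Lemma tangent_at0 u : tangent_at u 0.
Proof. by apply: tangent_ext (@tangent0 _ _ _) => x; rewrite quad0. Qed.

Lemma tangent_at_chord u a b (q : R) : edge G u a -> edge G u b -> a != b ->
  let i := [set u; a] in let j := [set u; b] in
  tangent_at u ((q%:C%C / (z j - z i)) *: chord (z i) (z j)).
Proof.
move=> ea eb ab i j.
apply: tangent_ext (tangent_chord (rr_neq0 ea) (touch_left ea) (touch_left eb)
  (packing_neq hz ea eb ab) (conj_real q)) => x.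
by rewrite quadZ quad_chord.
Qed.

Lemma tangent_at_omega u v (l : R) : int_edge G u v ->
  tangent_at u ((l%:C%C / omega G z u v) *: chord (z [set u; v])
    (z [set u; v])).
Proof.
case/int_edgeP=> s [t [gs gt]].
have euv := face_edge gs; have [h1 h2 h3] := points_neq gs gt.
have eus : edge G u s by rewrite (edgeC G) (face_edge (face_rot2 hG gs)).
have eut : edge G u t by rewrite (face_edge (face_rot hG gt)).
apply: tangent_ext (tangent_double (rr_neq0 euv) (touch_left euv)
  (touch_right eus) (touch_right eut) h1 h2 h3 (conj_real l)) => x.
by rewrite quadZ quad_chord (omegaE gs gt) expr2.
Qed.

Lemma koebe_closed (l : {ffun {set V} -> R}) u : koebe_differential G z l ->
  u \in int_vertices G ->
  \sum_(v | edge G u v) ((l [set u; v])%:C%C / omega G z u v)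
     *: chord (z [set u; v]) (z [set u; v]) = 0.
Proof.
move=> kl hu; apply/sum_chord_eq0; split.
- exact: (koebe_sum0 kl).
- transitivity (2 * \sum_(v | edge G u v)
  (l [set u; v])%:C%C / omega G z u v * z [set u; v]).
    by rewrite mulr_sumr; apply: eq_bigr => v _; ring.
  by rewrite (koebe_sum1 kl) // mulr0.
- by rewrite -[RHS](koebe_sum2 kl hu); apply: eq_bigr => v _; rewrite expr2.
Qed.

Lemma weierstrass_chord (l : {ffun {set V} ->
  R}) F : koebe_weierstrass G z l F <->
  forall u v, int_edge G u v -> F (left_face G u v) - F (right_face G u v) =
    ((l [set u; v])%:C%C / omega G z u v) *: chord (z [set u; v])
      (z [set u; v]).
Proof. by split=> h u v /h; rewrite /= koebe_chord. Qed.

(** The edge vectors are antisymmetric by [omega_antisym] and closed by [koebe_closed];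
    [cochain_exact] integrates each coordinate. *)
Lemma koebe_realization (l : {ffun {set V} -> R}) : koebe_differential G z l ->
  exists F, koebe_weierstrass G z l F.
Proof.
move=> kl; pose J u v := ((l [set u; v])%:C%C / omega G z u v)
     *: chord (z [set u; v]) (z [set u; v]).
have /boolp.choice[f hf] : forall i : 'I_3, exists F : {set V} -> C,
    forall u v, int_edge G u v ->
      F (left_face G u v) - F (right_face G u v) = J u v i ord0.
  move=> i; apply: (cochain_exact hG (c := fun u v => J u v i ord0)).
    move=> u v /omega_antisym e; rewrite /J
      (finset.setUC [set v]) e mulrN scaleNr.
    by rewrite [LHS]mxE.
  by move=> u hu; rewrite -summxE koebe_closed // mxE.
exists (fun A => \col_i f i A); apply/weierstrass_chord => u v h.
by apply/colP=> i; rewrite -/(J u v) -(hf i u v h) !mxE.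
Qed.

Lemma koebe_of_realization (l : {ffun {set V} -> R}) F :
  (forall e, e \notin int_edges G -> l e = 0) ->
  koebe_weierstrass G z l F -> koebe_differential G z l.
Proof.
move=> sup /weierstrass_chord kF.
have cl u : u \in int_vertices G ->
    \sum_(v | edge G u v) ((l [set u; v])%:C%C / omega G z u v)
     *: chord (z [set u; v]) (z [set u; v]) = 0.
  move=> hu; rewrite -[RHS](sum_jump0 hG F hu); apply: eq_bigr => v.
  by move=> /(int_vertex_edge hu)/kF ->.
split=> // u /cl/sum_chord_eq0[h0 h1 h2] //.
apply: (mulfI (_ : 2 != 0 :> C)); first by rewrite pnatr_eq0.
rewrite mulr0 -[RHS]h1 mulr_sumr; apply: eq_bigr => v _; ring.
Qed.

(** Each jump across an edge at [u] is tangent to the circle of [u], and tangent fields add up along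
    the faces around [u]. *)
Lemma tangent_around (l : {ffun {set V} -> R}) F u v s v' s' :
  koebe_weierstrass G z l F -> G u v s -> G u v' s' ->
  tangent_at u (F [set u; v'; s'] - F [set u; v; s]).
Proof.
move=> /weierstrass_chord kF g g'.
apply: (@link_propagate _ _ hG (fun f => tangent_at u
  (F f - F [set u; v; s])) u _ v s v' s') => //; last first.
  by rewrite subrr; apply: tangent_at0.
move=> w h; have t := tangent_at_omega (l [set u; w]) h;
  rewrite -(kF u w h) in t.
split=> h1.
  have := tangent_atD h1 (tangent_atN t); congr (tangent_at u _).
  by rewrite opprB addrCA [_ - _ - _]addrAC subrr sub0r.
have := tangent_atD h1 t; congr (tangent_at u _).
by rewrite addrC addrA subrK.
Qed.

(** The jump across an edge is a multiple of [(x - z_i)^2], so both adjacent polynomials take the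
    same value at the tangency point [z_i]. *)
Lemma edge_values (l : {ffun {set V} -> R}) F : koebe_weierstrass G z l F ->
  exists h : {set V} -> C, forall u v s, G u v s ->
    quad (F [set u; v; s]) (z [set u; v]) = h [set u; v].
Proof.
move=> /weierstrass_chord kF; pose P e (p : V * V * V) :=
  G p.1.1 p.1.2 p.2 && (e == [set p.1.1; p.1.2]).
exists (fun e => if [pick p | P e p] is Some p
  then quad (F [set p.1.1; p.1.2; p.2]) (z e) else 0) => u v s g.
case: pickP => [[[u' v'] s'] /= /andP[/= g' /eqP/set2_inj[[eu ev]|[eu ev]]]|].
- by subst u' v'; rewrite (face_inj hG g g').
- subst u' v'; have h : int_edge G u v by apply/int_edgeP; exists s, s'.
  apply/eqP; rewrite -subr_eq0 -quadB.
  have := kF u v h; rewrite (left_faceE hG g) (right_faceE hG g') => ->.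
  by rewrite quadZ quad_chord subrr mul0r mulr0.
- by move=> /(_ (u, v, s)); rewrite /P /= g eqxx.
Qed.

Lemma face_values (F : {set V} -> 'cV[C]_3) h :
  (forall u v s, G u v s -> quad (F [set u; v; s])
    (z [set u; v]) = h [set u; v]) ->
  forall u v s, G u v s -> forall x, x \in medial_face u v s ->
    quad (F [set u; v; s]) (z x) = h x.
Proof.
move=> hh u v s g x; rewrite !inE => /orP[/orP[]|] /eqP ->.
- exact: hh.
- by rewrite set3_rot; apply: hh; apply: (face_rot hG).
- by rewrite -set3_rot; apply: hh; apply: (face_rot2 hG).
Qed.

(** * Interpolation and differentials on the medial triangulation *)

Variable T : {set V} -> {set V} -> {set V} -> bool.
Hypothesis hT : medial_triangulation G T.
Let dT : triangulated_disk T := medial_disk hT.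

Lemma medial_points_neq i j : edge T i j -> z i != z j.
Proof.
by case/(medial_adjacent hG hT)=> u [a [b [-> -> ea eb ab]]];
  apply: (packing_neq hz).
Qed.

Lemma triangle_eq i j k (K K' : 'cV[C]_3) : T i j k ->
  (forall x, x \in [set i; j; k] -> quad K (z x) = quad K' (z x)) -> K = K'.
Proof.
move=> h e; have tj := face_rot dT h; have tk := face_rot dT tj.
have e0 x : x \in [set i; j; k] -> quad (K - K') (z x) = 0.
  by move=> /e; rewrite quadB => ->; rewrite subrr.
apply/eqP; rewrite -subr_eq0; apply/eqP.
apply: (quad_root3 (medial_points_neq (face_edge h)) (medial_points_neq
  (face_edge tj))
  (medial_points_neq (face_edge tk))); apply: e0; by rewrite !inE eqxx ?orbT.
Qed.

Lemma triangle_interp (h : {set V} -> C) :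
  exists Fh : {set {set V}} -> 'cV[C]_3, forall i j k, T i j k ->
    forall x, x \in [set i; j; k] -> quad (Fh [set i; j; k]) (z x) = h x.
Proof.
have /boolp.choice[Fh hF] : forall A : {set {set V}}, exists K,
    A \in faces T -> forall x, x \in A -> quad K (z x) = h x.
  move=> A; have [/facesP[i [j [k [-> t]]]]|nA] := boolP (A \in faces T);
    last by exists 0.
  have tj := face_rot dT t; have tk := face_rot dT tj.
  have [K [Ki Kj Kk]] := quad_interp (h i) (h j) (h k) (medial_points_neq
    (face_edge t))
     (medial_points_neq (face_edge tj)) (medial_points_neq (face_edge tk)).
  by exists K => _ x; rewrite !inE => /orP[/orP[]|] /eqP ->.
by exists Fh => i j k /mem_faces; apply: hF.
Qed.

(** Writing [z j] as [z i + (z j - z i)] expresses the three coefficients of each term through [q]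
    and [e j], so three equations reduce to two. *)
Lemma general_chord_terms i (q : {ffun {set {set V}} -> R}) :
  let e j := (q [set i; j])%:C%C / (z j - z i) in
  (\sum_(j | edge T i j) e j *: chord (z i) (z j) = 0) <->
  (\sum_(j | edge T i j) q [set i; j] = 0 /\ \sum_(j | edge T i j) e j = 0).
Proof.
move=> e; have E j : edge T i j -> e j * (z i + z j) =
  (q [set i; j])%:C%C + 2 * z i * e j.
  move=> /medial_points_neq; rewrite eq_sym -subr_eq0 => n.
  by rewrite /e; field.
have E0 j : edge T i j -> e j * (z i * z j) = z i * (q [set i; j])%:C%C + z i
  ^+ 2 * e j.
  move=> /medial_points_neq; rewrite eq_sym -subr_eq0 => n.
  by rewrite /e; field.
have S : (\sum_(j | edge T i j) q [set i; j])%:C%C =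
    \sum_(j | edge T i j) (q [set i; j])%:C%C :> C by rewrite rmorph_sum.
split=> [/sum_chord_eq0[h0 h1 h2]|[hq he]].
  split=> //; apply: (@complexI R); rewrite S; move: h1.
  by rewrite (eq_bigr _ E) big_split /= -mulr_sumr h0 mulr0 addr0.
rewrite hq in S; apply/sum_chord_eq0; split=> //.
  by rewrite (eq_bigr _ E) big_split /= -mulr_sumr he mulr0 addr0 -S.
by rewrite (eq_bigr _ E0) big_split /= -!mulr_sumr he mulr0 addr0 -S mulr0.
Qed.

Lemma general_of_realization (q : {ffun {set {set V}} -> R}) Fh :
  (forall e, e \notin int_edges T -> q e = 0) ->
  general_weierstrass T z q Fh -> general_differential T z q.
Proof.
move=> sup kF.
have cl i : i \in int_vertices T -> \sum_(j | edge T i j) q [set i; j] = 0 /\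
    \sum_(j | edge T i j) (q [set i; j])%:C%C / (z j - z i) = 0.
  move=> hi; apply/general_chord_terms; rewrite -[RHS](sum_jump0 dT Fh hi).
  by apply: eq_bigr => j /(int_vertex_edge hi)/kF ->.
by split=> // i /cl[].
Qed.

Lemma general_realization (q : {ffun {set {set V}} -> R}) :
  general_differential T z q -> exists Fh, general_weierstrass T z q Fh.
Proof.
move=> gq; pose J i j := ((q [set i; j])%:C%C / (z j - z i)) *: chord (z i)
  (z j).
have /boolp.choice[f hf] : forall d : 'I_3, exists F : {set {set V}} -> C,
    forall i j, int_edge T i j ->
      F (left_face T i j) - F (right_face T i j) = J i j d ord0.
  move=> d; apply: (cochain_exact dT (c := fun i j => J i j d ord0)).
    move=> i j _; have -> : J j i = - J i j; last by rewrite mxE.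
    rewrite /J /chord [z j * _]mulrC [z j + _]addrC (finset.setUC [set j]).
    by rewrite -[z i - z j]opprB invrN mulrN scaleNr.
  move=> i hi; rewrite -summxE.
  have -> : \sum_(j | edge T i j) J i j = 0; last by rewrite mxE.
  by apply/general_chord_terms; split; [apply: (general_sum gq)|apply:
    (general_sumV gq)].
exists (fun A => \col_d f d A) => i j h.
by apply/colP=> d; rewrite -/(chord _ _) -/(J i j) -(hf d i j h) !mxE.
Qed.

(** On a medial triangle the interpolant is the value of [F] on a face at [u]. Otherwise all three
    points lie on the circle of [u], and [tangent_interp] reduces tangency to these points. *)
Lemma tangent_triangle (l : {ffun {set V} -> R}) F h Fh u v s i j k :
  koebe_weierstrass G z l F ->
  (forall a b d, G a b d -> quad (F [set a; b; d])
    (z [set a; b]) = h [set a; b]) ->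
  (forall x, x \in [set i; j; k] -> quad Fh (z x) = h x) ->
  T i j k -> u \in i -> u \in j -> G u v s ->
  tangent_at u (Fh - F [set u; v; s]).
Proof.
move=> kF hh hFh t ui uj g.
have hi := medial_edges hT t; have tj := face_rot dT t; have tk :=
  face_rot dT tj.
have hj := medial_edges hT tj; have hk := medial_edges hT tk.
case: (medial_cases hG hT t) => [[a [b [d [gab ei ej ek]]]]|[w [wi wj wk]]].
  have bu : b = u.
    by apply: (edges_share hi hj (face_neq dT t)) => //;
      rewrite ?ei ?ej ?set21 ?set22.
  subst b; have -> : Fh = F [set u; d; a].
    apply: (triangle_eq t) => x hx; rewrite hFh // -set3_rot.
    by rewrite (face_values hh gab) // /medial_face -ei -ej -ek.
  by apply: (tangent_around kF g); apply: (face_rot hG).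
have wu : w = u by apply: (edges_share hi hj (face_neq dT t)).
subst w; set K := Fh - _.
have on x : x \in edges G -> u \in x -> on_circle (c u) (rr u) (z x).
  by move=> hx /(edge_at hx)[a ea ->]; apply: touch_left.
have rel x : x \in [set i; j; k] -> x \in edges G -> u \in x ->
    (quad K (z x))^* * (z x - c u) ^+ 2 = - rr u * quad K (z x).
  (* At [z x] the interpolant agrees with [F f] for a face [f] of [G] at the edge [x], and [F f - F
     [set u; v; s]] is tangent by [tangent_around]. *)
  move=> xijk hx ux; have onx := on x hx ux; move: (edge_at hx ux) => [a ea ex].
  have [f [tf ef]] : exists f, tangent_at u
    (F f - F [set u; v; s]) /\ quad (F f) (z x) = h x.
    case/edge_face: ea => s' [] g'.
      exists [set u; a; s']; split; first exact: (tangent_around kF g g').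
      by rewrite ex hh.
    exists [set a; u; s']; split; last by rewrite ex (finset.setUC [set u]) hh.
    by rewrite set3_rot; apply: (tangent_around kF g); apply: (face_rot hG).
  have := tf (z x) onx; rewrite /K !quadB ef -hFh //.
have eu : edge G u v := face_edge g.
apply: (tangent_interp (rr_neq0 eu) (on _ hi ui) (on _ hj uj) (on _ hk wk)
  (medial_points_neq (face_edge t)) (medial_points_neq (face_edge tj))
  (medial_points_neq (face_edge tk))); apply: rel; by rewrite ?inE ?eqxx ?orbT.
Qed.

Lemma koebe_to_general (l : {ffun {set V} ->
  R}) F : koebe_weierstrass G z l F ->
  exists q Fh, [/\ general_differential T z q, general_weierstrass T z q Fh
    & forall u v s, G u v s -> Fh (medial_face u v s) = F [set u; v; s]].
Proof.
move=> kF; have [h hh] := edge_values kF; have [Fh hFh] := triangle_interp h.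
pose D i j := Fh (left_face T i j) - Fh (right_face T i j).
(* The jump vanishes at [z i] and [z j], both triangles sharing these interpolated values. It is
   tangent to the circle through both points, which makes the coefficient real. *)
have DP i j : int_edge T i j -> D i j = coef2 (D i j) *: chord (z i) (z j) /\
    (coef2 (D i j) * (z j - z i))^* = coef2 (D i j) * (z j - z i).
  move=> hij; have eij := int_edgeW hij.
  have [u [a [b [ei ej ea eb ab]]]] := medial_adjacent hG hT eij.
  have [v [s g]] : exists v s, G u v s.
    case/edge_face: ea => s [] g; first by exists a, s.
    by exists s, a; apply: (face_rot hG).
  case/int_edgeP: hij => k [m [t t']].
  have ui : u \in i by rewrite ei set21.
  have uj : u \in j by rewrite ej set21.
  have tg : tangent_at u (D i j).
    rewrite /D (left_faceE dT t) (right_faceE dT t').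
    have t1 := tangent_triangle kF hh (hFh _ _ _ t) t ui uj g.
    have t2 := tangent_triangle kF hh (hFh _ _ _ t') t' uj ui g.
    have := tangent_atD t1 (tangent_atN t2); congr (tangent_at u _).
    by rewrite opprB addrA subrK.
  have D0 x : x \in [set i; j] -> quad (D i j) (z x) = 0.
    move=> hx; rewrite /D (left_faceE dT t) (right_faceE dT t') quadB.
    rewrite !hFh ?subrr //; move: hx; rewrite !inE => /orP[] ->;
      by rewrite ?orbT.
  have e := quad_root2 (medial_points_neq eij) (D0 _ (set21 i j)) (D0 _
    (set22 i j)).
  split=> //; apply: (tangent_chord_real (c := c u) (rr := rr u)).
  - exact: rr_neq0 ea.
  - by rewrite ei; apply: touch_left.
  - by rewrite ej; apply: touch_left.
  apply: tangent_ext tg => x; by rewrite {1}e quadZ quad_chord.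
(* By [DP] the number under [complex.Re] is already real; taking the real part only moves it into
   [R]. *)
have [|q [q0 qE]] := @symmetric_edge_function _ _ T
    (fun i j => complex.Re (coef2 (D i j) * (z j - z i))).
  move=> i j _; have -> : D j i = (-1) *: D i j by rewrite /D scaleN1r opprB.
  have [-> _ _] := quad_coefZ (-1) (D i j); congr complex.Re; ring.
have wq : general_weierstrass T z q Fh.
  move=> i j hij /=; rewrite qE //; have [e /conj_realP ->] := DP i j hij.
  rewrite mulfK; first exact: e.
  by rewrite subr_eq0 eq_sym (medial_points_neq (int_edgeW hij)).
exists q, Fh; split=> //; first exact: general_of_realization wq.
move=> a b d g; have t := medial_faces hT g; apply: (triangle_eq t) => x hx.
by rewrite (hFh _ _ _ t) // (face_values hh g).
Qed.

Lemma general_to_koebe (q : {ffun {set {set V}} ->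
  R}) Fh : general_weierstrass T z q Fh ->
  exists l F, [/\ koebe_differential G z l, koebe_weierstrass G z l F
    & forall u v s, G u v s -> Fh (medial_face u v s) = F [set u; v; s]].
Proof.
move=> wq; pose F (f : {set V}) := Fh [set e in edges G | e \subset f].
have FE u v s : G u v s -> Fh (medial_face u v s) = F [set u; v; s].
  by move=> g; rewrite /F (medial_faceE hG g).
(* By [medial_jump] the difference is a sum of jumps across chords from [z [set u; v]] along the
   circle of [u]: each is tangent to that circle and vanishes at this point. *)
have jumps u v s t : G u v s -> G v u t ->
    tangent_at u (F [set v; u; t] - F [set u; v; s]) /\
    quad (F [set v; u; t] - F [set u; v; s]) (z [set u; v]) = 0.
  move=> gs gt; have euv := face_edge gs.
  have hi : [set u; v] \in int_vertices T.
    by rewrite (medial_int_vertices hT) (mem_int_edges G); apply/int_edgeP;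
      exists s, t.
  rewrite -!FE // -(medial_jump hG hT Fh gs gt); split.
    apply: (big_ind (tangent_at u)); [exact: tangent_at0|exact: tangent_atD|].
    move=> j /andP[ej uj]; rewrite (wq _ _ (int_vertex_edge hi ej)).
    have hj : j \in edges G.
      by rewrite -(medial_vertices hT); rewrite edgeC in ej;
        apply: edge_vertex ej.
    have [b eb jb] := edge_at hj uj; subst j; apply: tangent_at_chord => //.
    by apply: contra (edge_neq dT ej) => /eqP ->.
  rewrite quad_sum big1 // => j /andP[ej uj];
    rewrite (wq _ _ (int_vertex_edge hi ej)).
  by rewrite quadZ quad_chord subrr mul0r mulr0.
pose J u v := F (left_face G u v) - F (right_face G u v).
have JP u v : int_edge G u v ->
    J u v = coef2 (J u v) *: chord (z [set u; v]) (z [set u; v]) /\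
    (coef2 (J u v) * omega G z u v)^* = coef2 (J u v) * omega G z u v.
  move=> /int_edgeP[s [t [gs gt]]]; have euv := face_edge gs.
  have evu : edge G v u by rewrite (edgeC G).
  have eus : edge G u s by rewrite (edgeC G) (face_edge (face_rot2 hG gs)).
  have eut : edge G u t by rewrite (face_edge (face_rot hG gt)).
  have [tu ju] := jumps u v s t gs gt; have [tv jv] := jumps v u t s gt gs.
  have EJ : J u v = F [set u; v; s] - F [set v; u; t].
    by rewrite /J (left_faceE hG gs) (right_faceE hG gt).
  rewrite -EJ in tv jv; rewrite finset.setUC in jv.
  have {ju}tu : tangent_at u (J u v).
    by rewrite EJ; have := tangent_atN tu; rewrite opprB.
  have [p [ep pr p1]] := touch_centers euv.
  (* The jump is tangent to both circles and vanishes at their point of contact; [d0] says that this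
     zero is double. *)
  have d0 := tangent_two_circles (rr_neq0 euv) (rr_neq0 evu) (touch_left euv)
    (touch_right evu) ep pr p1 (tangent_ext (fun x => quad_root x jv) tu)
    (tangent_ext (fun x => quad_root x jv) tv).
  have e : J u v = coef2 (J u v) *: chord (z [set u; v]) (z [set u; v]).
    apply: quad_factor jv _; apply/eqP; rewrite -subr_eq0 -d0; apply/eqP; ring.
  split=> //; rewrite (omegaE gs gt); have [h1 h2 h3] := points_neq gs gt.
  apply: (tangent_double_real (rr_neq0 euv) (touch_left euv)
    (touch_right eus) (touch_right eut) h1 h2 h3).
  by apply: tangent_ext tu => x; rewrite {1}e quadZ quad_chord expr2.
have [|l [l0 lE]] := @symmetric_edge_function _ _ G
    (fun u v => complex.Re (coef2 (J u v) * omega G z u v)).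
  move=> u v h; have -> : J v u = (-1) *: J u v by rewrite /J scaleN1r opprB.
  have [-> _ _] := quad_coefZ (-1) (J u v); congr complex.Re.
  have -> : omega G z v u = - omega G z u v.
    by apply: invr_inj; rewrite omega_antisym // invrN.
  ring.
have wl : koebe_weierstrass G z l F.
  apply/weierstrass_chord => u v h.
  rewrite lE //; have [e /conj_realP ->] := JP u v h.
  by rewrite mulfK ?omega_neq0.
by exists l, F; split=> //; apply: koebe_of_realization wl.
Qed.

(** Jumps across the edges of [T] at [i] vanish at [z i], so all triangles at [i] share one value
    there. *)
Lemma value_around (q : {ffun {set {set V}} -> R}) Fh i j k j' k' :
  general_weierstrass T z q Fh -> T i j k -> T i j' k' ->
  quad (Fh [set i; j; k]) (z i) = quad (Fh [set i; j'; k']) (z i).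
Proof.
move=> wq t t'; apply: (@link_propagate _ _ dT
  (fun f => quad (Fh [set i; j; k]) (z i) = quad (Fh f) (z i)) i _ j k j' k')
    => // m h.
suff -> : quad (Fh (left_face T i m)) (z i) = quad (Fh (right_face T i m))
  (z i) by [].
apply/eqP; rewrite -subr_eq0 -quadB wq //.
by rewrite quadZ quad_chord subrr mul0r mulr0.
Qed.

(** Every point belongs to a medial triangle, which by [value_around] fixes the value there for all
    triangles; three values determine a quadratic polynomial. *)
Lemma medial_determines (q q' : {ffun {set {set V}} -> R}) Fh Fh' t :
  general_weierstrass T z q Fh -> general_weierstrass T z q' Fh' ->
  (forall u v s, G u v s -> Fh' (medial_face u v s) = Fh
    (medial_face u v s) + t) ->
  forall f, f \in faces T -> Fh' f = Fh f + t.
Proof.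
move=> wq wq' e f /facesP[i [j [k [-> h]]]]; apply: (triangle_eq h).
have val a b d : T a b d ->
    quad (Fh' [set a; b; d]) (z a) = quad (Fh [set a; b; d] + t) (z a).
  move=> h'; have [u [v [s [g ea ta]]]] :=
    medial_at_edge hT (medial_edges hT h').
  rewrite quadD (value_around wq h' ta) (value_around wq' h' ta) -quadD.
  by rewrite ea [[set [set u; v]; _; _]]/(medial_face u v s) -e.
move=> x; rewrite !inE => /orP[/orP[]|] /eqP ->; first exact: val.
  by rewrite set3_rot; apply/val/(face_rot dT).
by rewrite -set3_rot; apply/val/(face_rot2 dT).
Qed.

(** A translation does not change jumps, and the leading coefficient of a jump is
    [q / (z j - z i)]. *)
Lemma general_inj (q q' : {ffun {set {set V}} -> R}) Fh Fh' t :
  (forall e, e \notin int_edges T -> q e = 0) ->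
  (forall e, e \notin int_edges T -> q' e = 0) ->
  general_weierstrass T z q Fh -> general_weierstrass T z q' Fh' ->
  (forall f, f \in faces T -> Fh' f = Fh f + t) -> q = q'.
Proof.
move=> q0 q0' wq wq' e; apply/ffunP=> x.
have [/int_edgesP[i [j [-> h]]]|nx] := boolP (x \in int_edges T);
  last by rewrite q0 ?q0'.
have := wq' _ _ h; rewrite (e _ (left_face_faces dT h)) (e _
  (right_face_faces dT h)) opprD addrACA subrr addr0 wq // => /(congr1
  (@coef2 R)).
have [-> _ _] := quad_coefZ ((q [set i; j])%:C%C / (z j - z i)) (chord (z i)
  (z j)).
have [-> _ _] := quad_coefZ ((q' [set i; j])%:C%C / (z j - z i)) (chord (z i)
  (z j)).
have [-> _ _] := quad_coef_chord (z i) (z j).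
rewrite !mulr1; move/mulIf => /(_ _)/complexI; apply.
by rewrite invr_eq0 subr_eq0 eq_sym (medial_points_neq (int_edgeW h)).
Qed.

Lemma koebe_inj (l l' : {ffun {set V} -> R}) F F' t :
  (forall e, e \notin int_edges G -> l e = 0) ->
  (forall e, e \notin int_edges G -> l' e = 0) ->
  koebe_weierstrass G z l F -> koebe_weierstrass G z l' F' ->
  (forall f, f \in faces G -> F' f = F f + t) -> l = l'.
Proof.
move=> l0 l0' /weierstrass_chord wl /weierstrass_chord wl' e; apply/ffunP=> x.
have [/int_edgesP[u [v [-> h]]]|nx] := boolP (x \in int_edges G);
  last by rewrite l0 ?l0'.
have := wl' _ _ h; rewrite (e _ (left_face_faces hG h)) (e _
  (right_face_faces hG h)) opprD addrACA subrr addr0 wl // => /(congr1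
  (@coef2 R)).
set a := z _.
have [-> _ _] := quad_coefZ ((l [set u; v])%:C%C / omega G z u v) (chord a a).
have [-> _ _] := quad_coefZ ((l' [set u; v])%:C%C / omega G z u v) (chord a a).
have [-> _ _] := quad_coef_chord a a.
rewrite !mulr1; move/mulIf => /(_ _)/complexI; apply.
by rewrite invr_eq0 omega_neq0.
Qed.
End Packing.

Theorem theorem6p1 (R : realType) (V : finType) (G : V -> V -> V -> bool)
    (hG : triangulated_disk G)
    (circ : V -> set R[i]) (z : {set V} -> R[i])
    (hz : circle_packing G circ z)
    (T : {set V} -> {set V} -> {set V} -> bool)
    (hT : medial_triangulation G T) :
  exists Phi : {ffun {set V} -> R} -> {ffun {set {set V}} -> R},
    set_bij [set l | koebe_differential G z l]%classic
            [set q | general_differential T z q]%classic Phi /\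
    forall l, koebe_differential G z l ->
      [/\ defines_realization G (koebe_weierstrass G z l),
          defines_realization T (general_weierstrass T z (Phi l))
        & forall F Fh, koebe_weierstrass G z l F ->
            general_weierstrass T z (Phi l) Fh ->
            exists t, forall u v s, G u v s ->
              Fh (medial_face u v s) = (F [set u; v; s] + t)%R].
Proof.
have [c [rr hc]] := packing_centers hz.
have rr0 u : u \in vertices G -> rr u != 0 by move=> /hc[].
have circE u : u \in vertices G -> forall x, circ u x <->
  on_circle (c u) (rr u) x.
  by move=> /hc[].
have dT := medial_disk hT.
(* The correspondence as a relation: some realizations of [l] and [q] agree exactly on the medial
   triangles. [Phi] selects one such [q], with default 0 off the Koebe differentials. *)
pose Rel l q := general_differential T z q /\ exists F Fh,
  [/\ koebe_weierstrass G z l F, general_weierstrass T z q Fh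
    & forall u v s, G u v s -> Fh (medial_face u v s) = F [set u; v; s]].
have [Phi hPhi] : exists Phi, forall l, koebe_differential G z l ->
  Rel l (Phi l).
  suff /boolp.choice[Phi h] : forall l, exists q, koebe_differential G z l ->
    Rel l q.
    by exists Phi.
  move=> l; have [kl|nk] := boolp.pselect (koebe_differential G z l);
    last by exists 0.
  have [F kF] := koebe_realization hG hz rr0 circE kl.
  have [q [Fh [gq wq e]]] := koebe_to_general hG hz rr0 circE hT kF.
  by exists q => _; split=> //; exists F, Fh.
have kU l F F' : koebe_weierstrass G z l F -> koebe_weierstrass G z l F' ->
    exists t, forall f, f \in faces G -> F' f = F f + t.
  by move=> w w'; apply: (realization_unique hG) => u v h; rewrite w // w'.
have gU q F F' : general_weierstrass T z q F -> general_weierstrass T z q F' ->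
    exists t, forall f, f \in faces T -> F' f = F f + t.
  by move=> w w'; apply: (realization_unique dT) => u v h; rewrite w // w'.
have mf u v s : G u v s -> medial_face u v s \in faces T.
  by move=> /(medial_faces hT)/mem_faces.
exists Phi; split; [split|].
- by move=> l /= /hPhi[].
(* Injectivity: the realizations on [T] differ by a translation, hence so do those on [G], whose
   jumps recover [l]. *)
- move=> l l' /[!inE] /= kl kl' e.
  have [_ [F [Fh [wF wFh m]]]] := hPhi l kl.
  have [_ [F' [Fh' [wF' wFh' m']]]] := hPhi l' kl'; rewrite -e in wFh'.
  have [t ht] := gU _ _ _ wFh wFh'.
  apply: (koebe_inj hG hz (koebe_support kl) (koebe_support kl') wF wF' (t :=
    t)).
  by move=> f /facesP[u [v [s [-> g]]]]; rewrite -m // -m' // ht // mf.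
(* Surjectivity: [q] yields some [l]. The realizations of [q] and [Phi l] differ by a translation on
   medial triangles, hence on all of [T], so their jumps give [Phi l = q]. *)
- move=> q /= gq; have [Fh wFh] := general_realization hG hz hT gq.
  have [l [F [kl wF m]]] := general_to_koebe hG hz rr0 circE hT wFh.
  exists l => //; have [gq' [F' [Fh' [wF' wFh' m']]]] := hPhi l kl.
  have [t ht] := kU _ _ _ wF' wF.
  apply: (general_inj hG hz hT (general_support gq')
    (general_support gq) wFh' wFh (t := t)).
  apply: (medial_determines hG hz hT wFh' wFh) => u v s g.
  by rewrite m // m' // ht // mem_faces.
- move=> l kl; have [gq [F [Fh [wF wFh m]]]] := hPhi l kl.
  split.
  + by split; [exists F|apply: kU].
  + by split; [exists Fh|apply: gU].
  + move=> F' Fh' wF' wFh'; have [t ht] := kU _ _ _ wF' wF.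
    have [t' ht'] := gU _ _ _ wFh wFh'; exists (t + t') => u v s g.
    by rewrite ht' ?mf // m // ht ?mem_faces // addrA.
Qed.
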